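(* Let $H$ be a nonempty acyclic oriented graph and put $p=p(H)$. (1) If $H$ is $F_{0,3}$-free or $F_{3,0}$-free, then $\tau(H)=O(p^4)$ (that is, $\tau(H)\le Cp^4$ for an absolute constant $C$). If $H$ is $F_{1,2}$-free or $F_{2,1}$-free and $p\ge2$, then $\tau(H)\le 2p-2$. (2) If $H$ is $F_{\mathrm{dir}}$-free, then $p\le3$ and $\tau(H)\le4$. If $H$ is $F_{\mathrm{turn}}$-free and $p\ge2$, then $\tau(H)\le2p-2$. If $H$ is $F_{\mathrm{alt}}$-free, then $\tau(H)\le3p-2$; if in addition $U(H)$ is triangle-free, then $\tau(H)=p$. The same conclusions hold when each forbidden oriented tree is replaced by the orientation obtained by reversing all its arcs.
   Context: All graphs and digraphs are finite. An oriented graph is a loopless digraph with no pair of opposite arcs (and no parallel arcs); it is acyclic if it has no directed cycle. $U(H)$ denotes the underlying simple undirected graph of $H$. A tournament is an orientation of a complete graph. A homomorphism is a vertex map preserving every arc. $H$ is $F$-free if no (not necessarily induced) subgraph of $H$ is isomorphic to $F$. For a nonempty acyclic oriented graph $H$, $p(H)$ is the maximum number of vertices on a directed path in $H$. The compressibility $\tau(H)$ is the least positive integer $n$ such that $H$ admits a homomorphism to every tournament of order $n$. For $a+b=3$, $F_{a,b}$ is the orientation of the star $K_{1,3}$ whose center has indegree $a$ and outdegree $b$. The following are orientations of the path on four distinct vertices $a,b,c,d$: $F_{\mathrm{dir}}$: $a\to b\to c\to d$; $F_{\mathrm{turn}}$: $a\to b\to c\leftarrow d$; $F_{\mathrm{alt}}$: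 $a\to b\leftarrow c\to d$. *)

(* Defs.v *)
From mathcomp Require Import all_boot.
From mathcomp Require Import boolp.

Set Implicit Arguments.
Unset Strict Implicit.
Unset Printing Implicit Defensive.

Record digraph := Digraph { vertex :> finType; darc : rel vertex }.

Arguments Digraph : clear implicits.
Arguments darc {d} x y.

Definition oriented (D : digraph) : Prop :=
  irreflexive (@darc D) /\ forall x y : D, darc x y -> ~~ darc y x.

Definition acyclic (D : digraph) : Prop :=
  forall s : seq D, ucycle (@darc D) s -> s = [::].

Definition tournament (D : digraph) : Prop :=
  oriented D /\ forall x y : D, x != y -> darc x y || darc y x.

Record acyclicOriented := AcyclicOriented {
  digraph_of :> digraph;
  digraph_ofP : oriented digraph_of;
  digraph_of_acyclic : acyclic digraph_of }.

Definition homomorphism (D E : digraph) (f : D -> E) : Prop :=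
  forall x y : D, darc x y -> darc (f x) (f y).

Definition isomorphic (D E : digraph) : Prop :=
  exists2 f : D -> E, bijective f & forall x y : D, darc (f x) (f y) = darc x y.

(* A subgraph is given by a vertex set [W] and an arc set [A], which need not
   contain all the arcs of [D] between vertices of [W]. *)
Definition is_subgraph (D : digraph) (W : {set D}) (A : {set D * D}) : Prop :=
  forall x y : D, (x, y) \in A -> [/\ x \in W, y \in W & darc x y].

Definition subgraph (D : digraph) (W : {set D}) (A : {set D * D}) : digraph :=
  Digraph {x : D | x \in W} (fun x y => (val x, val y) \in A).

Definition free_of (F D : digraph) : Prop :=
  forall (W : {set D}) (A : {set D * D}),
    is_subgraph W A -> ~ isomorphic F (subgraph W A).

Lemma free_ofP (F D : digraph) :
  free_of F D <-> ~ exists2 f : F -> D, injective f & homomorphism f.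
Proof.
split=> [FD [f fI fH] | nf W A WA [f fbij fE]].
  pose W := [set f x | x in [set: F]].
  pose A := [set (f u.1, f u.2) | u in [set u : F * F | darc u.1 u.2]].
  have WA : is_subgraph W A.
    move=> x y /imsetP[[u v]]; rewrite inE /= => uv [-> ->].
    by split; [apply: imset_f | apply: imset_f | apply: fH].
  have fW x : f x \in W by apply: imset_f.
  apply: (FD W A WA); exists (fun x => exist (fun z => z \in W) (f x) (fW x)).
    apply: inj_card_bij => [x y /(congr1 val)/=/fI // |].
    by rewrite card_sig card_imset // cardsT.
  move=> x y; rewrite /darc /=; apply/imsetP/idP => [[[u v]]|xy].
    by rewrite inE /= => uv [/fI -> /fI ->].
  by exists (x, y); rewrite ?inE.
apply: nf; exists (fun x => val (f x)).
  by move=> x y /val_inj; apply: bij_inj.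
by move=> x y; rewrite -fE => /WA[].
Qed.

Definition reverse (D : digraph) : digraph := Digraph D (fun x y => darc y x).

(* Adjacency in the underlying simple graph. *)
Definition U (D : digraph) : rel D :=
  fun x y => (x != y) && (darc x y || darc y x).

Definition triangle_free (V : finType) (e : rel V) : Prop :=
  forall x y z : V, ~~ [&& e x y, e y z & e x z].

Definition longest_path (D : digraph) : nat :=
  \max_(k < #|D|.+1 | [exists t : k.-tuple D, uniq t && sorted (@darc D) t]) k.

Definition maps_to_tournaments (D : digraph) (n : nat) : Prop :=
  forall T : digraph, tournament T -> #|T| = n ->
    exists f : D -> T, homomorphism f.

Lemma exists_sink (V : finType) (e : rel V) (S : {set V}) :
  (forall s : seq V, ucycle e s -> s = [::]) -> S != set0 ->
  exists2 x, x \in S & forall y, y \in S -> ~~ e x y.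
Proof.
move=> acy /set0Pn[x0 x0S]; apply: contrapT => nsink.
have step x : x \in S -> exists2 y, y \in S & e x y.
  move=> xS; apply: contrapT => nx; apply: nsink; exists x => // y yS.
  by apply/negP => xy; apply: nx; exists y.
pose g x := odflt x [pick y in S | e x y].
have gP x : x \in S -> (g x \in S) && e x (g x).
  move=> xS; rewrite /g; case: pickP => //= ny.
  by have [y yS xy] := step x xS; move: (ny y); rewrite yS xy.
have iter_in i : iter i g x0 \in S.
  by elim: i => //= i /gP/andP[].
have /trajectP[i ilt iE] := looping_order g x0.
pose n := order g x0; set y := iter i g x0 in iE.
have cyc : ucycle e (traject g y (n - i)).
  apply/andP; split; last first.
    have : uniq (orbit g x0) by apply: orbit_uniq.
    by rewrite /orbit -(subnKC (ltnW ilt)) trajectD cat_uniq => /and3P[].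
  case nE: (n - i) => [//|k] /=.
  have cg : path (frel g) y (rcons (traject g (g y) k) y).
    rewrite rcons_path fpath_traject /= last_traject /= -iterS /y -iterD.
    by rewrite -nE subnK ?(ltnW ilt) // iE.
  have yk : all (mem S) (y :: rcons (traject g (g y) k) y).
    have yS : y \in S by apply: iter_in.
    rewrite /= all_rcons /= yS /=; apply/allP => z /trajectP[j _ ->] /=.
    by rewrite -iterSr /y -iterD; apply: iter_in.
  apply: (sub_in_path (P := mem S)) cg => // a b aS _ /= /eqP <-.
  by case/andP: (gP a aS).
by have := acy _ cyc => /(congr1 size); rewrite size_traject /= => /eqP;
  rewrite subn_eq0 leqNgt ilt.
Qed.

Lemma exists_source (D : digraph) (S : {set D}) : acyclic D -> S != set0 ->
  exists2 x, x \in S & forall y, y \in S -> ~~ darc y x.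
Proof.
move=> acy; apply: exists_sink => s /andP[cs us].
by apply/(can_inj revK)/acy; rewrite /ucycle rev_cycle cs rev_uniq.
Qed.

Lemma maps_to_large_tournaments (H : acyclicOriented) :
  maps_to_tournaments H (2 ^ #|H|).
Proof.
move=> T [[_ _] Ttot] cT; have acy : acyclic H := @digraph_of_acyclic H.
suff main k (S : {set H}) (A : {set T}) : #|S| = k -> 2 ^ k <= #|A| ->
    exists2 f : H -> T, forall x, x \in S -> f x \in A &
      forall x y, x \in S -> y \in S -> darc x y -> darc (f x) (f y).
  have [||f _ fH] := @main #|H| setT setT; rewrite ?cardsT ?cT //.
  by exists f => x y; apply: fH; rewrite inE.
elim: k S A => [|k IHk] S A cS cA.
  have /card_gt0P[v _] : 0 < #|A| by apply: leq_trans cA.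
  by exists (fun=> v) => [x|x y]; rewrite (cards0_eq cS) inE.
have /card_gt0P[v vA] : 0 < #|A| by apply: leq_trans cA; rewrite expn_gt0.
have S0 : S != set0 by rewrite -card_gt0 cS.
pose O := [set w in A | (w != v) && darc v w].
pose I := [set w in A | (w != v) && darc w v].
have cOI : 2 ^ k <= #|O| \/ 2 ^ k <= #|I|.
  have sub : A \subset v |: (O :|: I).
    apply/subsetP => w wA; rewrite !inE wA; case: eqVneq => //= wv.
    by rewrite orbC; apply: Ttot.
  have := leq_trans cA (subset_leq_card sub).
  have cU := leq_trans (leq_card_setU [set v] (O :|: I))
    (leq_add (leqnn _) (leq_card_setU O I)).
  move=> /leq_trans /(_ cU); rewrite cards1 expnS mul2n -addnn => le1.
  case: (leqP (2 ^ k) #|O|) => [|ltO]; [by left | right].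
  by rewrite -(leq_add2l (2 ^ k)); apply: leq_trans le1 _; rewrite addnA leq_add2r.
have rec s (B : {set T}) : s \in S -> 2 ^ k <= #|B| ->
    exists2 f : H -> T, forall x, x \in S :\ s -> f x \in B &
      forall x y, x \in S :\ s -> y \in S :\ s -> darc x y -> darc (f x) (f y).
  by move=> sS cB; apply: IHk cB; move: cS; rewrite (cardsD1 s) sS => -[].
case: cOI => [cO | cI].
  have [s sS ssrc] := exists_source acy S0.
  have [f fA fH] := rec s O sS cO.
  exists (fun x => if x == s then v else f x) => [x xS | x y xS yS xy].
    by case: eqVneq => // xs; have := fA x; rewrite !inE xs xS => /(_ isT)/andP[].
  have ys : y != s by apply: contraTneq xy => ->; apply: ssrc.
  rewrite (negPf ys); case: eqVneq => [_ | xs].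
    by have := fA y; rewrite !inE ys yS => /(_ isT)/and3P[].
  by apply: fH; rewrite // !inE ?xs ?ys.
have [s sS ssnk] := exists_sink acy S0.
have [f fA fH] := rec s I sS cI.
exists (fun x => if x == s then v else f x) => [x xS | x y xS yS xy].
  by case: eqVneq => // xs; have := fA x; rewrite !inE xs xS => /(_ isT)/andP[].
have xs : x != s by apply: contraTneq xy => ->; apply: ssnk.
rewrite (negPf xs); case: (eqVneq y s) => [_ | ys].
  by have := fA x; rewrite !inE xs xS => /(_ isT)/and3P[].
by apply: fH; rewrite // !inE ?xs ?ys.
Qed.

Lemma compressible (H : acyclicOriented) :
  exists n, (0 < n) && `[< maps_to_tournaments H n >].
Proof.
exists (2 ^ #|H|); rewrite expn_gt0 /=.
by apply/asboolP; apply: maps_to_large_tournaments.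
Qed.

(* The compressibility of [H]. *)
Definition tau (H : acyclicOriented) : nat := ex_minn (compressible H).

(* [star a b] is F_{a,b}: the centre is [0], its in-neighbours are [1..a] and
   its out-neighbours are [a+1..a+b]. *)
Definition star (a b : nat) : digraph :=
  Digraph 'I_(a + b).+1
    (fun x y : 'I_(a + b).+1 =>
       [&& 0 < x, x <= a & y == 0 :> nat] || (x == 0 :> nat) && (a < y)).

Definition of_arcs (n : nat) (s : seq (nat * nat)) : digraph :=
  Digraph 'I_n (fun x y : 'I_n => (x : nat, y : nat) \in s).

Definition F_dir : digraph := of_arcs 4 [:: (0, 1); (1, 2); (2, 3)].
Definition F_turn : digraph := of_arcs 4 [:: (0, 1); (1, 2); (3, 2)].
Definition F_alt : digraph := of_arcs 4 [:: (0, 1); (2, 1); (2, 3)].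

(* Main.v *)
Require Import Defs.
From mathcomp Require Import all_boot all_order all_algebra.
From mathcomp Require Import boolp zify ring lra.

(* Reversing all arcs exchanges the two cases of the theorem, and [tau H >= p]
   because a transitive tournament receives only paths it is long enough for.

   If every vertex with an in-neighbour has at most one out-neighbour, or if [H]
   omits [F_turn], the levels of [H] change by one along every arc, except for
   arcs leaving sources.  So [H] maps to a vertex of out-degree at least [p - 1]
   followed by a Hamiltonian path of its out-neighbourhood.

   For [F_alt] the target is a Hamiltonian path in which any two nonconsecutive
   vertices, in order, are also joined by a walk of length two.  Each triangle
   [c -> a -> b], [c -> b] of [H] has an apex [a] of degree two; it is deleted and
   put back by means of a walk of length two.  The arcs of the tournament without
   such a walk form disjoint paths and cycles, so a third of the vertices avoids
   them: this is where [3p - 2] comes from.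

   If out-degrees are at most two, it suffices to find sets [W_0, ..., W_(p-1)],
   each containing the previous one, such that any two vertices of [W_i] have a
   common in-neighbour in [W_(i+1)]; in particular one nonempty set in which any
   two vertices have a common in-neighbour is enough.  Take a tournament with
   [p * m] vertices, where [m] is of order [p^3].  Either repeated majority
   domination produces the [W_i], or by a minimax argument some subset carries
   a weight without large atoms for which every in-neighbourhood weighs about one
   half.  In the latter case a random sample of bounded size is not closed under
   common in-neighbours only if many pairs of vertices have nearly complementary
   in-neighbourhoods.  Unless there is a transitive subtournament on [p] vertices,
   this yields three cyclic triangles [A => B => C => A], whose union is closed. *)

Set Implicit Arguments.
Unset Strict Implicit.
Unset Printing Implicit Defensive.

(** * Levels and paths *)

Lemma acyclic_ind (D : digraph) (P : D -> Prop) : acyclic D ->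
  (forall x, (forall y, darc x y -> P y) -> P x) -> forall x, P x.
Proof.
move=> acy step x; apply: contrapT => nPx.
have S0 : [set y | ~~ `[< P y >]] != set0.
  by apply/set0Pn; exists x; rewrite inE; apply/asboolP.
have [y] := exists_sink acy S0; rewrite inE => /asboolP nPy ysnk.
apply/nPy/step => z yz; apply: contrapT => nPz.
by have := ysnk z; rewrite inE yz => /(_ (introN (asboolP _) nPz)).
Qed.

(** The iterates of [F] stabilise at a vertex once they have done so at all its out-neighbours. *)
Lemma acyclic_rec (D : digraph) (A : Type) (F : (D -> A) -> D -> A) :
  A -> acyclic D ->
  (forall g h x, (forall y, darc x y -> g y = h y) -> F g x = F h x) ->
  exists g, forall x, g x = F g x.
Proof.
move=> a0 acy Fext; pose G n := iter n F (fun=> a0).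
have stab x : exists N, forall n, N <= n -> G n x = G N x.
  move: x; apply: (acyclic_ind acy) => x IH.
  have IH' y : exists Ny, darc x y -> forall n, Ny <= n -> G n y = G Ny y.
    by have [/IH[Ny NyP]|nxy] := boolP (darc x y); [exists Ny | exists 0].
  have [N NP] := choice IH'.
  exists (\max_y N y).+1 => -[//|n] ltn /=; apply: Fext => y xy.
  have leN : N y <= \max_y N y by apply: leq_bigmax.
  by rewrite -!/(G _) (NP y xy n) ?(NP y xy (\max_y N y)) // (leq_trans leN).
have [N NP] := choice stab; exists (G (\max_y N y)) => x.
have leN : N x <= \max_y N y by apply: leq_bigmax.
have := NP x _ (leqW leN); rewrite -(NP x _ leN) /= => {1}<-.
by [].
Qed.

(** The number of arcs of a longest path leaving [x]; on [reverse D] it counts from the sources. *)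
Definition is_level (D : digraph) (l : D -> nat) : Prop :=
  forall x, l x = \max_(y | darc x y) (l y).+1.

Lemma level_exists (D : digraph) : acyclic D -> exists l : D -> nat, is_level l.
Proof.
move=> acy; apply: (@acyclic_rec D nat
  (fun l x => \max_(y | darc x y) (l y).+1) 0) => // g h x gh.
by apply: eq_bigr => y /gh ->.
Qed.

Lemma level_lt (D : digraph) (l : D -> nat) (x y : D) :
  is_level l -> darc x y -> l y < l x.
Proof. by move=> lE xy; rewrite (lE x); apply: (leq_bigmax_cond _ xy). Qed.

Lemma level_attained (D : digraph) (l : D -> nat) (x : D) :
  is_level l -> 0 < l x -> exists2 y, darc x y & l x = (l y).+1.
Proof.
move=> lE; rewrite (lE x) => gt0.
have [y xy|nx] := pickP [pred y | darc x y]; last by rewrite big_pred0 in gt0.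
have c0 : 0 < #|[pred y | darc x y]| by apply/card_gt0P; exists y.
by have [z xz ->] := eq_bigmax_cond (fun y => (l y).+1) c0; exists z.
Qed.

Lemma level_step (D : digraph) (l : D -> nat) (x y : D) :
  is_level l -> darc x y -> (forall z, darc x z -> l z <= l y) ->
  l x = (l y).+1.
Proof.
move=> lE xy max_y; apply/eqP; rewrite eqn_leq level_lt // andbT.
by rewrite (lE x); apply/bigmax_leqP => z /max_y.
Qed.

Lemma size_le_longest_path (D : digraph) (s : seq D) :
  uniq s -> sorted (@darc D) s -> size s <= longest_path D.
Proof.
move=> us ss; have lts : size s < #|D|.+1.
  by rewrite ltnS -(card_uniqP us) max_card.
rewrite /longest_path; apply: (leq_bigmax_cond (Ordinal lts)).
by apply/existsP; exists (in_tuple s); rewrite us.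
Qed.

Lemma longest_path_attained (D : digraph) :
  exists s : seq D, [/\ uniq s, sorted (@darc D) s & size s = longest_path D].
Proof.
rewrite /longest_path; set P := (X in \max_(k < _ | X k) _).
have c0 : 0 < #|P|.
  by apply/card_gt0P; exists ord0; apply/existsP; exists [tuple].
have [k /existsP[t /andP[ut st]] ->] := eq_bigmax_cond (@nat_of_ord _) c0.
by exists t; rewrite size_tuple.
Qed.

Lemma level_path (D : digraph) (l : D -> nat) (x : D) : is_level l ->
  exists2 s, path (@darc D) x s & size s = l x.
Proof.
move=> lE; have [n] := ubnP (l x); elim: n x => // n IHn x /ltnSE lx.
have [lx0|gt0] := posnP (l x); first by exists [::]; rewrite ?lx0.
have [y xy lxE] := level_attained lE gt0.
have [|s ps ss] := IHn y; first by rewrite -lxE.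
by exists (y :: s); rewrite /= ?xy ?ss.
Qed.

Lemma level_lt_longest_path (D : digraph) (l : D -> nat) (x : D) :
  is_level l -> l x < longest_path D.
Proof.
move=> lE; have [s ps <-] := level_path x lE.
apply: (@size_le_longest_path D (x :: s)) => //.
have : sorted (fun y z => l z < l y) (x :: s).
  by apply: sub_path ps => y z; apply: level_lt.
apply: sorted_uniq => [y z t lyz lty|y]; last exact: ltnn.
exact: ltn_trans lty lyz.
Qed.

Lemma acyclic_irr (D : digraph) (x : D) : acyclic D -> ~~ darc x x.
Proof.
move=> acy; apply/negP => xx.
by have := acy [:: x]; rewrite /ucycle /= xx => /(_ isT).
Qed.

Lemma acyclic_asym (D : digraph) (x y : D) : acyclic D ->
  darc x y -> ~~ darc y x.
Proof.
move=> acy xy; apply/negP => yx.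
have [E|nxy] := eqVneq x y; first by have := acyclic_irr x acy; rewrite {2}E xy.
by have := acy [:: x; y]; rewrite /ucycle /= xy yx inE nxy => /(_ isT).
Qed.

Lemma acyclic_neq (D : digraph) (x y : D) : acyclic D -> darc x y -> x != y.
Proof.
by move=> acy; apply: contraTneq => ->; apply: acyclic_irr.
Qed.

Lemma acyclic_neq2 (D : digraph) (x y z : D) :
  acyclic D -> darc x y -> darc y z -> x != z.
Proof.
move=> acy xy; apply: contraTneq => <-; exact: acyclic_asym acy xy.
Qed.

Lemma sub_acyclic (D : digraph) (e : rel D) : acyclic D ->
  subrel e (@darc D) -> acyclic (Digraph D e).
Proof.
move=> acy sub [//|x s] /andP[cs us]; apply: acy; rewrite /ucycle us andbT.
exact: sub_path cs.
Qed.

Lemma sub_longest_path (D : digraph) (e : rel D) :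
  subrel e (@darc D) -> longest_path (Digraph D e) <= longest_path D.
Proof.
move=> sub; have [s [us ss <-]] := longest_path_attained (Digraph D e).
apply: (@size_le_longest_path D s us).
by case: s us ss => //= x s _; apply: sub_path.
Qed.

Lemma reverse_acyclic (D : digraph) : acyclic D -> acyclic (reverse D).
Proof.
move=> acy s /andP[cs us]; apply/(can_inj revK)/acy.
by rewrite /ucycle rev_cycle cs rev_uniq.
Qed.

Lemma reverse_longest_path (D : digraph) :
  longest_path (reverse D) = longest_path D.
Proof.
have le E : longest_path (reverse E) <= longest_path E.
  have [s [us ss <-]] := longest_path_attained (reverse E).
  rewrite -size_rev; apply: (@size_le_longest_path E); first by rewrite rev_uniq.
  by rewrite rev_sorted.
by apply/eqP; rewrite eqn_leq le /=; case: D => V e; apply: (le (reverse _)).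
Qed.

Lemma reverse_tournament (T : digraph) : tournament T -> tournament (reverse T).
Proof.
move=> [[irr asym] tot]; split; first by split=> // x y; apply: asym.
by move=> x y /tot; rewrite orbC.
Qed.

Lemma reverse_maps_to (D : digraph) (n : nat) :
  maps_to_tournaments (reverse D) n -> maps_to_tournaments D n.
Proof.
move=> revD T tT cT; have [f fH] := revD _ (reverse_tournament tT) cT.
by exists f => x y; apply: fH.
Qed.

Lemma tau_le (H : acyclicOriented) (n : nat) :
  0 < n -> maps_to_tournaments H n -> tau H <= n.
Proof.
rewrite /tau => n0 mapn; case: ex_minnP => k _; apply.
by rewrite n0; apply/asboolP.
Qed.

Lemma tau_ge (H : acyclicOriented) : longest_path H <= tau H.
Proof.
rewrite /tau; case: ex_minnP => n /andP[_ /asboolP mapn] _.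
pose T := Digraph 'I_n (fun i j => i < j).
have tT : tournament T.
  split=> [|i j]; last by rewrite neq_ltn.
  by split=> [i|i j]; rewrite /darc /= ?ltnn // -leqNgt; apply: ltnW.
have [f fH] := mapn T tT (card_ord n).
have [s [us ss <-]] := longest_path_attained H.
have um : uniq (map f s).
  apply: (@sorted_uniq _ (@darc T)) => [i j k|i|]; [exact: ltn_trans | exact: ltnn |].
  by apply: homo_sorted ss => x y; apply: fH.
by rewrite -(size_map f) -(card_ord n) -(card_uniqP um) max_card.
Qed.

Lemma longest_path_gt0 (D : digraph) : 0 < #|D| -> 0 < longest_path D.
Proof.
by case/card_gt0P => x _; apply: (@size_le_longest_path D [:: x]).
Qed.

Lemma free_reverse (F D : digraph) : free_of (reverse F) D -> free_of F (reverse D).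
Proof.
move=> /free_ofP fr; apply/free_ofP => -[f fI fH]; apply: fr.
by exists f => // x y; apply: fH.
Qed.

Lemma free_seq (n : nat) (r : rel 'I_n) (D : digraph) (x0 : D) (s : seq D) :
  free_of (Digraph 'I_n r) D -> uniq s -> size s = n ->
  ~ (forall i j : 'I_n, r i j -> darc (nth x0 s i) (nth x0 s j)).
Proof.
move=> /free_ofP fr us ss rH; apply: fr; exists (fun i : 'I_n => nth x0 s i) => //.
move=> i j /eqP; rewrite nth_uniq ?ss ?ltn_ord // => /eqP; exact: val_inj.
Qed.

(** * Spines of tournaments *)

Lemma tour_irr (T : digraph) (x : T) : tournament T -> darc x x = false.
Proof. by case=> -[irr _] _; apply: irr. Qed.

Lemma tour_asym (T : digraph) (x y : T) : tournament T -> darc x y -> ~~ darc y x.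
Proof. by case=> -[_ asym] _; apply: asym. Qed.

Lemma tour_conn (T : digraph) (x y : T) : tournament T ->
  x != y -> ~~ darc x y -> darc y x.
Proof. by case=> _ tot /tot/orP[->|]. Qed.

Lemma tour_neq (T : digraph) (x y : T) : tournament T -> darc x y -> x != y.
Proof. by move=> tT; apply: contraTneq => ->; rewrite tour_irr. Qed.

Definition two_walk (T : digraph) (W : {set T}) (x y : T) : bool :=
  [exists z in W, darc x z && darc z y].

Lemma two_walk_sub (T : digraph) (W W' : {set T}) (x y : T) :
  W \subset W' -> two_walk W x y -> two_walk W' x y.
Proof.
move=> sub /exists_inP[z zW xy]; apply/exists_inP.
by exists z => //; apply: (subsetP sub).
Qed.

(** A vertex [u] of largest out-degree inside [W] works: a vertex not reached within two steps would
    dominate [u] and all its out-neighbours. *)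
Lemma king_exists (T : digraph) (W : {set T}) : tournament T -> W != set0 ->
  exists2 u, u \in W & forall w, w \in W -> w != u -> darc u w || two_walk W u w.
Proof.
move=> tT /set0Pn[u0 u0W].
case: (@arg_maxnP _ u0 (mem W) (fun u => #|[set w in W | darc u w]|) u0W) => u uW umax.
exists u => // w wW wu; apply: contraT; rewrite negb_or => /andP[uw ntwo].
have wu_arc : darc w u by apply: tour_conn; rewrite // eq_sym.
have /= := umax w wW; rewrite leqNgt => /negP[].
have sub : u |: [set z in W | darc u z] \subset [set z in W | darc w z].
  apply/subsetP => z; rewrite !inE => /orP[/eqP->|/andP[zW uz]]; first by rewrite (uW : u \in W).
  rewrite zW /=; apply: tour_conn => //; first by apply: contraNneq uw => <-.
  by apply: contra ntwo => zw; apply/exists_inP; exists z; rewrite ?uz.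
by rewrite (leq_trans _ (subset_leq_card sub)) // cardsU1 !inE tour_irr // andbF.
Qed.

(* The middle of a walk of length two may lie anywhere in [W], not only between
   its two ends. *)
Fixpoint spine (T : digraph) (W : {set T}) (s : seq T) : bool :=
  if s is x :: s1 then
    (if s1 is y :: s2 then darc x y && all (two_walk W x) s2 else true)
    && spine W s1
  else true.

Lemma spine_cons2 (T : digraph) (W : {set T}) (x y : T) (s : seq T) :
  spine W [:: x, y & s] =
  [&& darc x y, all (two_walk W x) s & spine W (y :: s)].
Proof. by rewrite andbA. Qed.

Arguments spine : simpl never.

Lemma spine_sub (T : digraph) (W W' : {set T}) (s : seq T) :
  W \subset W' -> spine W s -> spine W' s.
Proof.
move=> sub; elim: s => // x [//|y s] IHs; rewrite !spine_cons2.
case/and3P=> -> xs /IHs ->; rewrite andbT.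
by apply: sub_all xs => z; apply: two_walk_sub.
Qed.

(** Old walks avoid [u] and survive. The last two hypotheses reach [u] from [s1], and the former
    predecessor of [v] now reaches [v] through [u]. *)
Lemma spine_insert (T : digraph) (W : {set T}) (u v : T) (s1 s2 : seq T) :
  u \in W -> darc u v -> spine (W :\ u) (s1 ++ v :: s2) ->
  all (two_walk W u) s2 ->
  {in s1, forall x, darc x v -> darc x u} ->
  {in s1 &, forall x y, darc x y -> two_walk (W :\ u) x v -> two_walk W x u} ->
  spine W (s1 ++ u :: v :: s2).
Proof.
move=> uW uv + us2; have sub : W :\ u \subset W by apply: subsetDl.
have up x s : all (two_walk (W :\ u) x) s -> all (two_walk W x) s.
  by apply: sub_all => z; apply: two_walk_sub.
elim: s1 => [|x [|y s1] IHs] /= sp hv hu; rewrite ?spine_cons2 in sp *.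
- by rewrite uv us2 (spine_sub sub sp).
- case/and3P: sp => xv /up xs2 /(spine_sub sub) sp.
  have xu : darc x u by rewrite hv ?inE.
  rewrite /= xu uv us2 xs2 sp !andbT; apply/exists_inP.
  by exists u; rewrite // xu uv.
case/and3P: sp => xy; rewrite !all_cat /= => /and3P[/up xs1 xv /up xs2] /IHs{}IHs.
rewrite xy xs1 (two_walk_sub sub xv) xs2 /=.
rewrite (hu x y) ?inE ?eqxx ?orbT //= -/cat IHs //.
  by move=> z zs; apply: hv; rewrite inE zs orbT.
by move=> z t zs ts; apply: hu; rewrite inE ?zs ?ts orbT.
Qed.

(** Induction on [W]: remove a king, take a spine of the rest, and insert the king just before a
    suitable out-neighbour. *)
Lemma spine_exists (T : digraph) (W : {set T}) : tournament T ->
  exists2 s, perm_eq s (enum W) & spine W s.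
Proof.
move=> tT; have [n] := ubnP #|W|; elim: n W => // n IHn W /ltnSE cW.
have [->|W0] := eqVneq W set0; first by exists [::]; rewrite // enum_set0.
have [u uW uking] := king_exists tT W0.
have [|s ps sps] := IHn (W :\ u); first by move: cW; rewrite (cardsD1 u) uW.
have ins s1 v s2 : s = s1 ++ v :: s2 -> perm_eq (s1 ++ u :: v :: s2) (enum W).
  move=> sE; rewrite -cat1s perm_catCA cat1s.
  rewrite -sE; apply: (@perm_trans _ (u :: enum (W :\ u))); first by rewrite perm_cons.
  apply: uniq_perm; rewrite /= ?enum_uniq ?andbT ?mem_enum ?inE ?eqxx //.
  move=> z; rewrite inE !mem_enum !inE.
  by case: (eqVneq z u) => [->|].
have sW x : x \in s -> x \in W /\ x != u.
  by rewrite (perm_mem ps) mem_enum !inE => /andP[].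
have [v /and3P[vW uv nuv]|nobad] :=
  pickP [pred v | [&& v \in W, darc u v & ~~ two_walk W u v]].
  (* [v] is the only vertex that [u] does not reach by a walk of length two,
     and every in-neighbour of [v] is one of [u]. *)
  have domv z : z \in W -> z != u -> darc z v -> darc z u.
    move=> zW zu zv; apply: (tour_conn tT); first by rewrite eq_sym.
    by apply: contra nuv => uz; apply/exists_inP; exists z; rewrite ?uz.
  have reach w : w \in W -> w != u -> w != v -> two_walk W u w.
    move=> wW wu wv; have := uking w wW wu; case uw: (darc u w) => //= _.
    apply/exists_inP; exists v; rewrite // uv /=; apply: (tour_conn tT) => //.
    by apply: contra nuv => wv_arc; apply/exists_inP; exists w; rewrite ?uw.
  have vs : v \in s.
    by rewrite (perm_mem ps) mem_enum !inE vW andbT eq_sym (tour_neq tT).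
  have us : uniq s by rewrite (perm_uniq ps) enum_uniq.
  have [s1 [s2 sE]] : exists s1 s2, s = s1 ++ v :: s2.
    by case/splitPr: vs => s1 s2; exists s1, s2.
  exists (s1 ++ u :: v :: s2); first exact: ins.
  move: sps us sW; rewrite sE => sps us sW; apply: spine_insert => //.
  - apply/allP => w ws2; have [|wW wu] := sW w; first by rewrite mem_cat inE ws2 !orbT.
    apply: reach => //; apply: contraTneq us => wv.
    by rewrite cat_uniq /= -wv ws2 /= !andbF.
  - by move=> x xs1; apply: domv; have [] := sW x; rewrite // mem_cat xs1.
  move=> x y _ _ _ /exists_inP[z]; rewrite !inE => /andP[zu zW] /andP[xz zv].
  by apply/exists_inP; exists z; rewrite // xz domv.
have reach w : w \in W -> w != u -> two_walk W u w.
  move=> wW wu; have := uking w wW wu; case uw: (darc u w) => //= _.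
  by apply: contraFT (nobad w) => nuw; rewrite /= wW uw.
(* A king without out-neighbours is alone in [W]; otherwise it goes just before its first
   out-neighbour. *)
have [hs|ns] := boolP (has (darc u) s); last first.
  exists [:: u] => //; apply: uniq_perm; rewrite ?enum_uniq // => w.
  rewrite mem_enum inE; have [->|wu] //= := eqVneq w u.
  apply/esym; apply: contraNF ns => wW.
  have /exists_inP[z zW /andP[uz _]] := reach w wW wu.
  apply/hasP; exists z => //.
  by rewrite (perm_mem ps) mem_enum !inE zW andbT eq_sym (tour_neq tT).
case/split_find: hs sW ps ins sps => v s1 s2 uv ns1 sW ps ins sps.
rewrite -cats1 -catA /= in sW ins sps.
exists (s1 ++ u :: v :: s2); first exact: ins.
have s1u x : x \in s1 -> darc x u.
  move=> xs1; have [|xW xu] := sW x; first by rewrite mem_cat xs1.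
  apply: (tour_conn tT); first by rewrite eq_sym.
  by apply: contra ns1 => ux; apply/hasP; exists x.
apply: spine_insert => //.
- apply/allP => w ws2; have [|wW wu] := sW w; first by rewrite mem_cat inE ws2 !orbT.
  exact: reach.
- by move=> x /s1u.
move=> x y xs1 ys1 xy _; apply/exists_inP; exists y; last by rewrite xy s1u.
by have [] := sW y; rewrite // mem_cat ys1.
Qed.

Lemma spine_behead (T : digraph) (W : {set T}) (x : T) (s : seq T) :
  spine W (x :: s) -> spine W s.
Proof. by case: s => // y s; rewrite spine_cons2 => /and3P[]. Qed.

Lemma spine_arc (T : digraph) (W : {set T}) (x0 : T) (s : seq T) (i : nat) :
  spine W s -> i.+1 < size s -> darc (nth x0 s i) (nth x0 s i.+1).
Proof.
elim: s i => // x s IHs [|i] sp lti; last by apply: IHs => //; apply: spine_behead sp.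
by case: s {IHs} sp lti => // y s; rewrite spine_cons2 => /and3P[].
Qed.

Lemma spine_two_walk (T : digraph) (W : {set T}) (x0 : T) (s : seq T) (i j : nat) :
  spine W s -> i.+1 < j -> j < size s -> two_walk W (nth x0 s i) (nth x0 s j).
Proof.
elim: s i j => // x s IHs [|i] [|j] // sp ltij ltj; last first.
  by apply: IHs => //; apply: spine_behead sp.
case: s {IHs} sp ltj => // y s; rewrite spine_cons2 => /and3P[_ /allP xs _].
by case: j ltij => // j _ ltj; apply: xs; apply: mem_nth.
Qed.

(** * Maps that follow the levels *)

Lemma large_outdegree (T : digraph) (k : nat) : tournament T -> 2 * k < #|T|.+1 ->
  0 < #|T| -> exists v : T, k <= #|[set w | darc v w]|.
Proof.
move=> tT ltk T0; apply: contrapT => nv.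
have small (v : T) : #|[set w | darc v w]| < k.
  by rewrite ltnNge; apply/negP => le; apply: nv; exists v.
have out_in : \sum_(v : T) #|[set w | darc v w]| = \sum_(v : T) #|[set w | darc w v]|.
  have cardE (e : rel T) v : #|[set w | e v w]| = \sum_(w : T) e v w.
    by rewrite -sum1dep_card big_mkcond; apply: eq_bigr => w _; case: (e v w).
  rewrite (eq_bigr _ (fun v _ => cardE (@darc T) v)) exchange_big /=.
  by apply: eq_bigr => v _; rewrite -(cardE (fun x y => darc y x)).
have deg (v : T) : #|[set w | darc v w]| + #|[set w | darc w v]| = #|T|.-1.
  rewrite -cardsUI [X in _ + X](_ : _ = 0); last first.
    apply/eqP; rewrite cards_eq0; apply/eqP/setP => w; rewrite !inE.
    by apply/negP => /andP[/(tour_asym tT)/negP].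
  rewrite addn0 -cardsT (cardsD1 v setT) inE /=; apply: eq_card => w.
  rewrite !inE andbT; have [->|wv] := eqVneq w v; first by rewrite tour_irr.
  by have [vw|/tour_conn] := boolP (darc v w); rewrite ?orbT // => -> //; rewrite eq_sym.
(* Out-degrees and in-degrees have the same sum, so they average [(#|T| - 1) / 2], which exceeds
   [k - 1]. *)
have : \sum_(v : T) #|T|.-1 <= \sum_(v : T) (k.-1 + k.-1).
  rewrite -(eq_bigr _ (fun v _ => deg v)) big_split /= -out_in -big_split /=.
  by apply: leq_sum => v _; have := small v; lia.
have /card_gt0P[v0 _] := T0; have := small v0.
rewrite !sum_nat_const (_ : #|xpredT| = #|T|) // leq_pmul2l //; lia.
Qed.

(** The path is a spine of a large out-neighbourhood; [2 * p - 2] is the least order for which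
    averaging gives out-degree [p - 1]. *)
Lemma dominated_path (T : digraph) (p : nat) : tournament T -> 2 <= p ->
  #|T| = 2 * p - 2 -> exists v : T, exists2 s : seq T, p.-1 <= size s &
    {in s, forall x, darc v x} /\
    forall i, i.+1 < size s -> darc (nth v s i) (nth v s i.+1).
Proof.
move=> tT p2 cT; have [||v outv] := @large_outdegree T p.-1 tT; try lia.
have [s ps sps] := spine_exists [set w | darc v w] tT.
exists v, s; first by rewrite (perm_size ps) -cardE.
split=> [x|i]; first by rewrite (perm_mem ps) mem_enum inE.
exact: (spine_arc v sps).
Qed.

Lemma unique_out_of_inner_maps (D : digraph) (p : nat) : acyclic D ->
  longest_path D <= p -> 2 <= p ->
  (forall x y z w : D, darc y x -> darc x z -> darc x w -> z = w) ->
  maps_to_tournaments D (2 * p - 2).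
Proof.
move=> acy lp p2 uout T tT cT.
have [v [s ss [vs sarc]]] := dominated_path tT p2 cT.
have [l lE] := level_exists acy.
pose src x := [forall y, ~~ @darc D y x].
(* A vertex that is not a source has level at most [p - 2], and its arcs lower the level by exactly
   one. Sources go to [v], which dominates the whole path, so their arcs may skip levels. *)
exists (fun x => if src x then v else nth v s (p.-2 - l x)) => x y xy.
have lp' z : l z < p by apply: leq_trans lp; apply: level_lt_longest_path.
have lin z t : @darc D z t -> l t < p.-1.
  by move=> /(level_lt lE) lt; have := lp' z; lia.
have -> : src y = false by apply/negbTE/forallPn; exists x; rewrite negbK.
have [srcx|/forallPn[z /negPn zx]] := boolP (src x).
  by apply/vs/mem_nth/(leq_trans _ ss); have := lin _ _ xy; lia.
have lxE : l x = (l y).+1.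
  by apply: level_step => // w xw; rewrite (uout x z w y zx).
have -> : p.-2 - l y = (p.-2 - l x).+1 by have := lin _ _ zx; lia.
by apply/sarc/(leq_trans _ ss); have := lin _ _ zx; lia.
Qed.

Lemma turn_free_maps (D : digraph) (p : nat) : acyclic D ->
  longest_path D <= p -> 2 <= p ->
  (forall a b c d : D, darc a b -> darc b c -> darc d c -> d = a \/ d = b) ->
  maps_to_tournaments D (2 * p - 2).
Proof.
move=> acy lp p2 turn T tT cT.
have [v [s ss [vs sarc]]] := dominated_path tT p2 cT.
have [l lE] := level_exists (reverse_acyclic acy).
(* Levels count from the sources here. If [z -> x -> y], every in-neighbour of [y] is [z] or [x], so
   the level rises by exactly one from [x] to [y]. *)
exists (fun x : D => if l x == 0 then v else nth v s (l x).-1) => x y xy.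
have lp' z : l z < p.
  apply: leq_trans lp; rewrite -reverse_longest_path.
  exact: level_lt_longest_path.
have lt := @level_lt (reverse D) l y x lE xy.
have -> : (l y == 0) = false by lia.
have [lx0|lx0] := eqVneq (l x) 0; first by apply/vs/mem_nth/(leq_trans _ ss); have := lp' y; lia.
have [z zx lxE] : exists2 z, @darc D z x & l x = (l z).+1.
  by apply: (@level_attained (reverse D)) => //; lia.
have -> : (l y).-1 = (l x).-1.+1.
  rewrite (@level_step (reverse D) l y x) //; first lia.
  by move=> w wy; have [->|->] := turn z x y w zx xy wy; rewrite // lxE.
by apply/sarc/(leq_trans _ ss); have := lp' y; lia.
Qed.

(** Some vertex has two out-neighbours; the resulting transitive triangle receives the three
    levels. *)
Lemma dir_free_maps (D : digraph) : acyclic D -> longest_path D <= 3 ->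
  maps_to_tournaments D 4.
Proof.
move=> acy lp T tT cT.
have [||v] := @large_outdegree T 2 tT; rewrite ?cT // => /card_gt1P[y [z []]].
rewrite !inE => vy vz yz; wlog yz_arc : y z vy vz yz / darc y z.
  move=> wl; have [|nyz] := boolP (darc y z); first exact: wl.
  by apply: (wl z y) => //; [rewrite eq_sym | apply: tour_conn].
have [l lE] := level_exists acy.
exists (fun x => nth v [:: z; y; v] (l x)) => x1 x2 x12.
have := level_lt lE x12; have := level_lt_longest_path x1 lE.
by case: (l x1) (l x2) => [|[|[|i]]] [|[|[|j]]] //=; lia.
Qed.

(* Place [v] at position [l v] of a spine, [l] being the level counted from the
   sources.  An arc that jumps ends at a vertex [b] with two in-neighbours, so
   its tail has no other out-neighbour.  Such a tail moves to the position just
   before [b], unless it has a unique in-neighbour [d]: then it becomes the middle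
   of a walk of length two from [d] to [b]. *)
Lemma no_alt_maps (D T : digraph) (W : {set T}) : acyclic D -> tournament T ->
  W != set0 -> longest_path D <= #|W| ->
  (forall a b c d : D, darc a b -> darc c b -> darc c d -> a = c \/ b = d) ->
  exists2 f : D -> T, homomorphism f & forall x, f x \in W.
Proof.
move=> acy tT /set0Pn[t0 t0W] lp noalt.
have [s ps sps] := spine_exists W tT.
have szs : size s = #|W| by rewrite (perm_size ps) -cardE.
have sW i : nth t0 s i \in W.
  have [lti|] := ltnP i (size s); last by move/(nth_default t0)->.
  by rewrite -mem_enum -(perm_mem ps) mem_nth.
have [l lE] : exists l : D -> nat, @is_level (reverse D) l.
  exact: level_exists (reverse_acyclic acy).
have lW (x : D) : l x < #|W|.
  apply: leq_trans lp; rewrite -reverse_longest_path.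
  exact: level_lt_longest_path.
have llt x y : @darc D x y -> l x < l y by apply: (@level_lt (reverse D)).
pose branch (b : D) := [exists a, exists c, [&& darc a b, darc c b & a != c]].
have branchN b a c : ~~ branch b -> @darc D a b -> darc c b -> a = c.
  move=> nb ab cb; apply: contraNeq nb => ac; apply/existsP; exists a.
  by apply/existsP; exists c; rewrite ab cb.
have branch_out b c d : branch b -> @darc D c b -> darc c d -> b = d.
  case/existsP=> a1 /existsP[a2 /and3P[a1b a2b a12]] cb cd.
  have [E1|] // := noalt a1 b c d a1b cb cd.
  by have [E2|] // := noalt a2 b c d a2b cb cd; rewrite E1 E2 eqxx in a12.
have lnext c b : ~~ branch b -> @darc D c b -> l b = (l c).+1.
  move=> nb cb; apply: (@level_step (reverse D)) => // a ab.
  by rewrite (branchN b a c).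
(* By [branch_out] a vertex pointing to a branch vertex has no other out-neighbour. A link also has
   exactly one in-neighbour, since it is not itself a branch vertex. *)
pose child v := [pick b | @darc D v b && branch b].
pose link v := (child v != None) && [exists d, @darc D d v] && ~~ branch v.
pose shift (g : D -> nat) v := if link v then l v else
  if child v is Some b then (g b).-1 else l v.
have [pos posE] : exists g, forall v, g v = shift g v.
  apply: (@acyclic_rec _ _ shift 0) => // g h x gh; rewrite /shift; case: (link x) => //.
  by rewrite /child; case: pickP => // b /andP[/gh->].
have childP v b : @darc D v b -> branch b -> child v = Some b.
  move=> vb bb; rewrite /child; case: pickP => [b'|/(_ b)]; last by rewrite vb bb.
  by case/andP=> vb' bb'; rewrite (branch_out b' v b).
(* Shifting only moves to the right, so [l d < l v < l b <= pos b] for a link [v] between [d] and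
   [b]: the two positions are far enough apart for a walk of length two. *)
have posP (v : D) : l v <= pos v < #|W|.
  move: v; apply: (acyclic_ind acy) => v IH; rewrite posE /shift.
  case: (link v); rewrite ?leqnn ?lW // /child.
  case: pickP => [b /andP[vb _]|]; last by rewrite leqnn lW.
  by have := IH b vb; have := llt v b vb; lia.
pose mid (v : D) := odflt t0 [pick z in W | [exists d, @darc D d v &&
  darc (nth t0 s (l d)) z] && oapp (fun b => darc z (nth t0 s (pos b))) false (child v)].
have linkP v d b : link v -> @darc D d v -> darc v b -> branch b ->
  [/\ mid v \in W, darc (nth t0 s (l d)) (mid v) & darc (mid v) (nth t0 s (pos b))].
  move=> /andP[_ nv] dv vb bb; rewrite /mid (childP v b) //=.
  case: pickP => [z /and3P[zW /existsP[d' /andP[d'v d'z]] zb]|].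
    by rewrite (branchN v d d' nv dv d'v).
  have := posP b; have := llt d v dv; have := llt v b vb.
  move=> lvb ldv /andP[lb posb].
  have /exists_inP[z zW /andP[dz zb]] :
      two_walk W (nth t0 s (l d)) (nth t0 s (pos b)).
    by apply: (spine_two_walk _ sps); rewrite ?szs //; lia.
  by move/(_ z); rewrite zW zb andbT => /existsP[]; exists d; rewrite dv.
exists (fun v => if link v then mid v else nth t0 s (pos v)); last first.
  move=> v; case: ifP => // _; rewrite /mid; case: pickP => //= z /andP[] //.
move=> c b cb; have [bb|nb] := boolP (branch b).
  have lb : link b = false by rewrite /link bb andbF.
  rewrite lb; have [lc|lc] := boolP (link c).
    have /andP[/andP[_ /existsP[d dc]] _] := lc.
    by have [] := linkP c d b lc dc cb bb.
  have -> : pos c = (pos b).-1 by rewrite posE /shift (negPf lc) (childP c b).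
  have := posP b; have := llt c b cb => lcb /andP[lb' posb].
  have -> : pos b = (pos b).-1.+1 by lia.
  by apply: (spine_arc _ sps); rewrite szs; lia.
have nchild : child c = None.
  rewrite /child; case: pickP => // b' /andP[cb' bb'].
  by have E := branch_out b' c b bb' cb' cb; rewrite -E bb' in nb.
have -> : link c = false by rewrite /link nchild.
have -> : pos c = l c by rewrite posE /shift nchild if_same.
case: ifP => [lb|lb].
  have := lb; rewrite /link; case E: (child b) => [b'|//] _.
  move: E; rewrite /child; case: pickP => // ? /andP[bb' bb'b] [Eb].
  by have [] := linkP b c _ lb cb bb' bb'b.
have nb' : child b = None.
  apply/eqP; move: lb; rewrite /link nb andbT; apply: contraFT => ->.
  by apply/existsP; exists c.
have -> : pos b = (l c).+1 by rewrite posE /shift lb nb' (lnext c b nb cb).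
by apply: (spine_arc _ sps); rewrite szs -(lnext c b nb cb).
Qed.

(** Greedy choice: each chosen vertex costs itself and at most two others, and the last choice needs
    only one vertex left. *)
Lemma independent_third (T : digraph) (e : rel T) (k : nat) (X : {set T}) :
  (forall x y z, e x y -> e x z -> y = z) ->
  (forall x y z, e y x -> e z x -> y = z) ->
  3 * k - 2 <= #|X| ->
  exists2 W : {set T}, W \subset X /\ #|W| = k & {in W &, forall x y, x != y -> ~~ e x y}.
Proof.
move=> uout uin; elim: k X => [|k IHk] X cX.
  exists set0; first by rewrite sub0set cards0.
  by move=> x y; rewrite inE.
have /card_gt0P[x xX] : 0 < #|X| by lia.
pose N := [set y | e x y || e y x]; pose Y := X :\: (x |: N).
have cN : #|N| <= 2.
  have sub1 (P : pred T) : (forall y z, P y -> P z -> y = z) -> #|[set y | P y]| <= 1.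
    by move=> P1; apply/card_le1_eqP => y z; rewrite !inE => Py Pz; apply: P1.
  have -> : N = [set y | e x y] :|: [set y | e y x] by apply/setP => y; rewrite !inE.
  rewrite cardsU; have := sub1 (e x) (uout x); have := sub1 (e^~ x) (uin x).
  by move=> le1 le2; apply: leq_trans (leq_subr _ _) _; apply: leq_add le2 le1.
have [|W [WY cW] Wind] := IHk Y.
  have := cardsID (x |: N) X; rewrite -/Y.
  have : #|X :&: (x |: N)| <= 3.
    apply: leq_trans (subset_leq_card (subsetIr _ _)) _.
    by rewrite cardsU1; lia.
  lia.
have WP y : y \in W -> [/\ y \in X, y != x, ~~ e x y & ~~ e y x].
  by move/(subsetP WY); rewrite !inE !negb_or => /andP[/and3P[-> -> ->] ->].
exists (x |: W).
  split; last first.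
    rewrite cardsU1 cW (_ : x \notin W) //.
    by apply/negP => /WP[_]; rewrite eqxx.
  apply/subsetP => y; rewrite !inE => /orP[/eqP->|/WP[]] //.
move=> y z; rewrite !inE => /orP[/eqP->|yW] /orP[/eqP->|zW].
- by rewrite eqxx.
- by case: (WP z zW).
- by case: (WP y yW).
exact: Wind.
Qed.

(** The forbidden path may only degenerate by [a = d], that is, into a triangle [c -> a -> b],
    [c -> b]. *)
Definition alt_free (D : digraph) : Prop :=
  forall a b c d : D, darc a b -> darc c b -> darc c d -> a != c -> b != d -> a = d.

Lemma alt_triangle_free_maps (D : digraph) (p : nat) : acyclic D ->
  longest_path D <= p -> 0 < p -> alt_free D -> triangle_free (@U D) ->
  maps_to_tournaments D p.
Proof.
move=> acy lp p0 alt tri T tT cT.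
have [|||f fH _] := @no_alt_maps D T setT acy tT; rewrite ?cardsT ?cT //.
- by rewrite -card_gt0 cardsT cT.
- move=> a b c d ab cb cd; have [|ac] := eqVneq a c; first by left.
  have [|bd] := eqVneq b d; first by right.
  have ad := alt a b c d ab cb cd ac bd; rewrite -ad in cd.
  have /negP[] := tri c a b; rewrite /U cd ab cb !(eq_sym c) ac (eq_sym b c) /=.
  by rewrite (acyclic_neq acy cb) (acyclic_neq acy ab).
by exists f.
Qed.

Lemma alt_free_maps (D : digraph) (p : nat) : acyclic D ->
  longest_path D <= p -> 0 < p -> alt_free D ->
  maps_to_tournaments D (3 * p - 2).
Proof.
move=> acy lp p0 alt T tT cT.
have asym := acyclic_asym acy.
have neq x y := @acyclic_neq D x y acy.
(* Two bad arcs cannot share a tail, nor a head: the arc joining their other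
   ends would complete a walk of length two along one of them. *)
pose bad (u v : T) := darc u v && ~~ two_walk setT u v.
have walk x y z : @darc T x y -> darc y z -> two_walk setT x z.
  by move=> xy yz; apply/exists_inP; exists y; rewrite ?inE ?xy.
have bad_out x y z : bad x y -> bad x z -> y = z.
  move=> /andP[xy nxy] /andP[xz nxz]; apply: contraTeq isT => yz.
  have [yz_arc|/(tour_conn tT yz) zy] := boolP (darc y z).
    by rewrite (walk x y z) in nxz.
  by rewrite (walk x z y) in nxy.
have bad_in x y z : bad y x -> bad z x -> y = z.
  move=> /andP[yx nyx] /andP[zx nzx]; apply: contraTeq isT => yz.
  have [yz_arc|/(tour_conn tT yz) zy] := boolP (darc y z).
    by rewrite (walk y z x) in nyx.
  by rewrite (walk z y x) in nzx.
have [|W [_ cW] Wgood] := @independent_third T bad p setT bad_out bad_in.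
  by rewrite cardsT cT.
(* In such a triangle [alt_free] leaves the apex [a] no neighbours but [c] and [b], and neither of
   these is an apex itself. *)
pose over (c a b : D) := [&& darc c a, darc a b & darc c b].
pose roof a := [exists c, exists b, over c a b].
have roof_in c a b x : over c a b -> darc x a -> x = c.
  case/and3P=> ca ab cb xa; apply/eqP; apply: contraT => xc.
  have xb := alt x a c b xa ca cb xc (neq _ _ ab).
  by rewrite xb (negPf (asym _ _ ab)) in xa.
have roof_out c a b y : over c a b -> darc a y -> y = b.
  case/and3P=> ca ab cb ay; apply/eqP; apply: contraT; rewrite eq_sym => yb.
  have cy := alt c b a y cb ab ay (neq _ _ ca) yb.
  by rewrite -cy (negPf (asym _ _ ca)) in ay.
have roofN x : ~~ roof x -> forall c b, ~~ over c x b.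
  by move=> nx c b; apply: contra nx => o; apply/existsP; exists c; apply/existsP; exists b.
have over_low c a b : over c a b -> ~~ roof c /\ ~~ roof b.
  case/and3P=> ca ab cb; split; apply/existsP => -[x /existsP[y o]].
    have := roof_out x c y a o ca; rewrite -(roof_out x c y b o cb) => E.
    by have := neq _ _ ab; rewrite E eqxx.
  have := roof_in x b y a o ab; rewrite -(roof_in x b y c o cb) => E.
  by have := neq _ _ ca; rewrite E eqxx.
(* Without the apices the case [a = d] cannot occur, so [no_alt_maps] applies with image in [W],
   where every arc is accompanied by a walk of length two. *)
pose e x y := [&& @darc D x y, ~~ roof x & ~~ roof y].
have sub : subrel e (@darc D) by move=> x y /and3P[].
have [|||f fH fW] := @no_alt_maps (Digraph D e) T W (sub_acyclic acy sub) tT.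
- by rewrite -card_gt0 cW.
- by rewrite cW; apply: leq_trans lp; apply: sub_longest_path.
- move=> a b c d /and3P[ab na _] /and3P[cb nc _] /and3P[cd _ _].
  have [|ac] := eqVneq a c; first by left.
  have [|bd] := eqVneq b d; first by right.
  have ad := alt a b c d ab cb cd ac bd; rewrite -ad in cd.
  by have := roofN a na c b; rewrite /over cd ab cb.
have low c b a : over c a b -> two_walk setT (f c) (f b).
  move=> o; have [nc nb] := over_low c a b o; have /and3P[_ _ cb] := o.
  have fcb : darc (f c) (f b) by apply: fH; rewrite /darc /= /e cb nc nb.
  have := Wgood _ _ (fW c) (fW b) (tour_neq tT fcb).
  by rewrite /bad fcb /= negbK.
pose mid a := odflt (f a) [pick z |
  [forall c, @darc D c a ==> darc (f c) z] &&
  [forall b, @darc D a b ==> darc z (f b)]].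
have midP c a b : over c a b -> darc (f c) (mid a) && darc (mid a) (f b).
  move=> o; have /and3P[ca ab _] := o; rewrite /mid; case: pickP => /= [z|].
    by case/andP=> /forallP/(_ c)/implyP cz /forallP/(_ b)/implyP zb; rewrite cz ?zb.
  have /exists_inP[z _ /andP[cz zb]] := low c b a o.
  move/(_ z)/negP; case; apply/andP; split; apply/forallP => y; apply/implyP => ay.
    by rewrite (roof_in c a b y).
  by rewrite (roof_out c a b y).
exists (fun x => if roof x then mid x else f x) => x y xy.
case: ifP => [/existsP[c /existsP[b o]]|/negbT nx].
  have Ey := roof_out c x b y o xy; have [_ /negbTE nb] := over_low c x b o.
  by rewrite Ey nb; case/andP: (midP c x b o).
case: ifP => [/existsP[c /existsP[b o]]|/negbT ny].
  by rewrite (roof_in c y b x o xy); case/andP: (midP c y b o).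
by apply: fH; rewrite /darc /= /e xy nx ny.
Qed.

(** * Out-degree at most two *)

Definition out_le2 (D : digraph) : Prop :=
  forall x y1 y2 y3 : D, darc x y1 -> darc x y2 -> darc x y3 ->
  [\/ y1 = y2, y1 = y3 | y2 = y3].

(** When [l] is a level, this is a homomorphism on a set closed under out-neighbours; the values of
    [f] elsewhere are arbitrary. *)
Definition maps_below (D T : digraph) (l : D -> nat) (k : nat) (S : {set T}) : Prop :=
  exists f : D -> T, forall x, l x < k ->
    f x \in S /\ forall y, darc x y -> darc (f x) (f y).

(** The case [y = z] is included, so every vertex of [S'] has an in-neighbour in [S]. *)
Definition covers_pairs (T : digraph) (S S' : {set T}) : Prop :=
  {in S' &, forall y z, exists2 x, x \in S & darc x y && darc x z}.

Definition cyclic3 (T : digraph) (X : {set T}) : Prop :=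
  exists a b c, [/\ a \in X, b \in X, c \in X & [&& @darc T a b, darc b c & darc c a]].

Lemma maps_below_sub (D T : digraph) (l : D -> nat) (k : nat) (S S' : {set T}) :
  S' \subset S -> maps_below l k S' -> maps_below l k S.
Proof. by move=> /subsetP sub [f fP]; exists f => x /fP[/sub]. Qed.

(** A vertex of level [k] has at most two out-neighbours, already placed in [S'], and goes to a
    common in-neighbour of their images. *)
Lemma maps_below_step (D T : digraph) (l : D -> nat) (k : nat) (S S' : {set T}) :
  is_level l -> out_le2 D -> S != set0 -> S' \subset S -> covers_pairs S S' ->
  maps_below l k S' -> maps_below l k.+1 S.
Proof.
move=> lE out2 /set0Pn[t0 t0S] /subsetP sub cov [f fP].
pose g x := if l x < k then f x else
  odflt t0 [pick t in S | [forall y, darc x y ==> darc t (f y)]].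
exists g => x; rewrite ltnS leq_eqVlt => /orP[/eqP lx|ltx]; last first.
  have [fS fH] := fP x ltx; rewrite /g ltx; split=> [|y xy]; first exact: sub.
  by rewrite (ltn_trans (level_lt lE xy) ltx); apply: fH.
have low y : darc x y -> l y < k by move=> xy; rewrite -lx; apply: level_lt.
have fS' y : darc x y -> f y \in S' by move=> /low /fP[].
have [t tS tH] : exists2 t, t \in S & forall y, darc x y -> darc t (f y).
  have [y1 xy1|nx] := pickP [pred y | darc x y]; last first.
    by exists t0 => // y; have := nx y; rewrite /= => ->.
  have [y2 /andP[xy2 y12]|nx] := pickP [pred y | darc x y & y != y1]; last first.
    have [t tS /andP[ty1 _]] := cov _ _ (fS' y1 xy1) (fS' y1 xy1).
    exists t => // y xy; have [->//|ny] := eqVneq y y1.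
    by have := nx y; rewrite /= xy ny.
  have [t tS /andP[ty1 ty2]] := cov _ _ (fS' y1 xy1) (fS' y2 xy2).
  exists t => // y xy; have [E|<-//|<-//] := out2 x y1 y2 y xy1 xy2 xy.
  by rewrite E eqxx in y12.
rewrite {1 2}/g lx ltnn; case: pickP => /= [t' /andP[t'S /forallP t'H]|/(_ t)].
  by split=> // y xy; rewrite /g low //; apply: (implyP (t'H y)).
by rewrite tS => /forallP[] y; apply/implyP/tH.
Qed.

Lemma maps_below0 (D T : digraph) (l : D -> nat) (S : {set T}) :
  S != set0 -> maps_below l 0 S.
Proof. by case/set0Pn => t _; exists (fun=> t). Qed.

Lemma maps_below_closed (D T : digraph) (l : D -> nat) (k : nat) (R : {set T}) :
  is_level l -> out_le2 D -> R != set0 -> covers_pairs R R -> maps_below l k R.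
Proof.
move=> lE out2 R0 cov; elim: k => [|k IHk]; first exact: maps_below0.
exact: (maps_below_step lE out2 R0 (subxx R)).
Qed.

(** Without cyclic triangles a king dominates the whole set, so it covers all pairs of the rest and
    can be removed. *)
Lemma maps_below_transitive (D T : digraph) (l : D -> nat) (k : nat) (X : {set T}) :
  is_level l -> out_le2 D -> tournament T -> X != set0 -> ~ cyclic3 X ->
  k <= #|X| -> maps_below l k X.
Proof.
move=> lE out2 tT; elim: k X => [|k IHk] X X0 nc kX; first exact: maps_below0.
have [u uX uking] := king_exists tT X0.
have dom w : w \in X -> w != u -> darc u w.
  move=> wX wu; have := uking w wX wu; case uw: (darc u w) => //= /exists_inP[z zX].
  case/andP=> uz zw; case: nc; exists u, z, w; split=> //.
  by rewrite uz zw; apply: (tour_conn tT); rewrite ?uw // eq_sym.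
have cX : #|X| = #|X :\ u|.+1 by rewrite (cardsD1 u) uX.
have [k0|k0] := posnP k.
  rewrite k0; apply: (maps_below_step lE out2 X0 (sub0set X)).
    by move=> y z; rewrite inE.
  by exists (fun=> u).
apply: (maps_below_step lE out2 X0 (subsetDl X [set u])).
  move=> y z; rewrite !inE => /andP[yu yX] /andP[zu zX].
  by exists u; rewrite // !dom.
apply: IHk.
- by rewrite -card_gt0; rewrite cX ltnS in kX; apply: leq_trans kX.
- move=> [a [b [c [aX bX cX' abc]]]]; apply: nc; exists a, b, c; split=> //.
  + by move: aX; rewrite inE => /andP[].
  + by move: bX; rewrite inE => /andP[].
  + by move: cX'; rewrite inE => /andP[].
by rewrite cX in kX.
Qed.

(** * Blow-ups of cyclic triangles *)

Lemma blowup_closed (T : digraph) (A B C : {set T}) :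
  A != set0 -> B != set0 -> C != set0 ->
  (forall x, x \in A -> exists2 y, y \in A & darc y x) ->
  (forall x, x \in B -> exists2 y, y \in B & darc y x) ->
  (forall x, x \in C -> exists2 y, y \in C & darc y x) ->
  {in A & B, forall x y, darc x y} -> {in B & C, forall x y, darc x y} ->
  {in C & A, forall x y, darc x y} ->
  covers_pairs (A :|: B :|: C) (A :|: B :|: C).
Proof.
move=> /set0Pn[a0 a0A] /set0Pn[b0 b0B] /set0Pn[c0 c0C] pA pB pC AB BC CA y z.
have inA x : x \in A -> x \in A :|: B :|: C by rewrite !inE => ->.
have inB x : x \in B -> x \in A :|: B :|: C by rewrite !inE => ->; rewrite orbT.
have inC x : x \in C -> x \in A :|: B :|: C by rewrite !inE => ->; rewrite orbT.
(* Two vertices of one part are dominated by the preceding part. For one in [A] and one in [B], an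
   in-neighbour of the former inside [A] dominates all of [B]; the other pairs follow cyclically. *)
rewrite !inE -!orbA => /or3P[yA|yB|yC] /or3P[zA|zB|zC].
- by exists c0; rewrite ?inC // !CA.
- by have [x xA xy] := pA y yA; exists x; rewrite ?inA // xy AB.
- by have [x xC xz] := pC z zC; exists x; rewrite ?inC // xz CA.
- by have [x xA xz] := pA z zA; exists x; rewrite ?inA // xz AB.
- by exists a0; rewrite ?inA // !AB.
- by have [x xB xy] := pB y yB; exists x; rewrite ?inB // xy BC.
- by have [x xC xy] := pC y yC; exists x; rewrite ?inC // xy CA.
- by have [x xB xz] := pB z zB; exists x; rewrite ?inB // xz BC.
by exists b0; rewrite ?inB // !BC.
Qed.

Definition triangles (T : digraph) (Y : {set T}) : {set T * T * T} :=
  [set t | [&& t.1.1 \in Y, t.1.2 \in Y, t.2 \in Y &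
    [&& darc t.1.1 t.1.2, darc t.1.2 t.2 & darc t.2 t.1.1]]].

Definition vertices3 (T : digraph) (t : T * T * T) : {set T} :=
  [set t.1.1; t.1.2; t.2].

Lemma triangle_pred (T : digraph) (Y : {set T}) (t : T * T * T) (x : T) :
  t \in triangles Y -> x \in vertices3 t -> exists2 y, y \in vertices3 t & darc y x.
Proof.
rewrite inE => /and4P[_ _ _ /and3P[ab bc ca]]; rewrite !inE -orbA.
case/or3P=> /eqP->; [exists t.2|exists t.1.1|exists t.1.2] => //;
  by rewrite !inE eqxx ?orbT.
Qed.

Lemma triangle_sub (T : digraph) (Y : {set T}) (t : T * T * T) (x : T) :
  t \in triangles Y -> x \in vertices3 t -> x \in Y.
Proof.
rewrite inE => /and4P[aY bY cY _]; rewrite !inE -orbA.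
by case/or3P=> /eqP->.
Qed.

Lemma cyclic3_triangle (T : digraph) (Y : {set T}) :
  cyclic3 Y -> exists t, t \in triangles Y.
Proof.
move=> [a [b [c [aY bY cY abc]]]]; exists (a, b, c).
by rewrite inE /= aY bY cY.
Qed.

(** Find a triangle, delete its first vertex and repeat: later triangles avoid the deleted vertices,
    so all are distinct. *)
Lemma many_triangles (T : digraph) (p k : nat) (Y : {set T}) :
  (forall X : {set T}, p <= #|X| -> cyclic3 X) ->
  p + k <= #|Y| -> k <= #|triangles Y|.
Proof.
move=> cyc; elim: k Y => // k IHk Y cY.
have [|t tY] := @cyclic3_triangle T Y; first by apply: cyc; lia.
have aY : t.1.1 \in Y by move: tY; rewrite inE => /and4P[].
have sub : t |: triangles (Y :\ t.1.1) \subset triangles Y.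
  apply/subsetP => s; rewrite in_setU1 => /orP[/eqP->//|].
  by rewrite !inE => /and4P[/andP[_ ->] /andP[_ ->] /andP[_ ->] ->].
apply: leq_trans (subset_leq_card sub).
rewrite cardsU1 [t \in _]inE !inE eqxx /= add1n ltnS; apply: IHk.
by rewrite (cardsD1 t.1.1 Y) aY add1n addnS ltnS in cY.
Qed.

(* A set of [2 * p] vertices carries [p] cyclic triangles, not just one; this
   saves a factor [p] and gives the exponent 4 in the end. *)
Lemma popular_triangle (T : digraph) (p : nat) (K Z : {set T}) :
  (forall X : {set T}, p <= #|X| -> cyclic3 X) -> 0 < p ->
  (forall z, z \in Z -> 2 * p <= #|[set b in K | darc b z]|) ->
  #|K| ^ 3 <= #|Z| -> 0 < #|Z| ->
  exists2 t, t \in triangles K &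
    p <= #|[set z in Z | [forall b in vertices3 t, darc b z]]|.
Proof.
move=> cyc p0 Zdeg KZ Z0; apply: contrapT => none.
pose N t := #|[set z in Z | [forall b in vertices3 t, darc b z]]|.
have small t : t \in triangles K -> N t <= p.-1.
  by move=> tK; rewrite -ltnS prednK // ltnNge; apply/negP => le; apply: none; exists t.
have cK : #|triangles K| <= #|K| ^ 3.
  have sub : triangles K \subset setX (setX K K) K.
    by apply/subsetP => -[[a b] c]; rewrite !inE /= => /and4P[-> -> ->].
  by apply: leq_trans (subset_leq_card sub) _; rewrite !cardsX; lia.
have : \sum_(t in triangles K) N t <= #|K| ^ 3 * p.-1.
  apply: (@leq_trans (\sum_(t in triangles K) p.-1)).
    by apply: leq_sum => t; apply: small.
  by rewrite sum_nat_const leq_mul2r cK orbT.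
(* Double counting of triangles against the vertices of [Z] they dominate: each vertex accounts for
   at least [p] pairs, each triangle for fewer than [p]. *)
suff : #|Z| * p <= \sum_(t in triangles K) N t by nia.
rewrite -sum_nat_const.
have NE t : N t = \sum_(z in Z) [forall b in vertices3 t, darc b z].
  rewrite /N -sum1dep_card big_mkcondr; apply: eq_bigr => z _.
  by case: ifP.
rewrite (eq_bigr _ (fun t _ => NE t)) exchange_big /=; apply: leq_sum => z zZ.
have := @many_triangles T p p [set b in K | darc b z] cyc.
rewrite addnn -mul2n => /(_ (Zdeg z zZ)) /leq_trans; apply.
rewrite -sum1_card big_mkcond [leqRHS]big_mkcond /=; apply: leq_sum => t _.
rewrite !inE; case: (t.1.1 \in K); case: (t.1.2 \in K); case: (t.2 \in K) => //=;
  rewrite ?andbF //.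
case: ifP => // /and4P[az bz cz ->]; rewrite lt0b.
by apply/forall_inP => b; rewrite !inE -orbA => /or3P[] /eqP->.
Qed.

(** * Weights and majority domination *)

Import Order.TTheory GRing.Theory Num.Theory.
Local Open Scope ring_scope.

Definition mass (R : realFieldType) (V : finType) (nu : V -> R) (A : {set V}) : R :=
  \sum_(x in A) nu x.

Definition weight_on (R : realFieldType) (V : finType) (S : {set V}) (nu : V -> R) : Prop :=
  [/\ forall x, 0 <= nu x, forall x, x \notin S -> nu x = 0 & \sum_x nu x = 1].

Lemma mass_ge0 (R : realFieldType) (V : finType) (nu : V -> R) (A : {set V}) :
  (forall x, 0 <= nu x) -> 0 <= mass nu A.
Proof. by move=> nu0; apply: sumr_ge0. Qed.

Lemma mass_sub (R : realFieldType) (V : finType) (nu : V -> R) (A B : {set V}) :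
  (forall x, 0 <= nu x) -> A \subset B -> mass nu A <= mass nu B.
Proof.
move=> nu0 sub; rewrite /mass [X in _ <= X](big_setID A) /= (setIidPr sub) lerDl.
exact: sumr_ge0.
Qed.

Lemma massUI (R : realFieldType) (V : finType) (nu : V -> R) (A B : {set V}) :
  mass nu (A :|: B) + mass nu (A :&: B) = mass nu A + mass nu B.
Proof.
rewrite /mass (big_setID A) /= [X in _ = _ + X](big_setID A) /= setUK setDUl setDv.
by rewrite set0U (setIC B) addrAC addrA.
Qed.

Lemma massU_le (R : realFieldType) (V : finType) (nu : V -> R) (A B : {set V}) :
  (forall x, 0 <= nu x) -> mass nu (A :|: B) <= mass nu A + mass nu B.
Proof. by move=> nu0; rewrite -massUI lerDl; apply: mass_ge0. Qed.

Lemma massC (R : realFieldType) (V : finType) (S : {set V}) (nu : V -> R) (A : {set V}) :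
  weight_on S nu -> mass nu (~: A) = 1 - mass nu A.
Proof.
case=> _ _ <-; rewrite [\sum_x nu x](bigID (mem A)) /= /mass addrAC subrr add0r.
by apply: eq_bigl => x; rewrite inE.
Qed.

Lemma mass_le1 (R : realFieldType) (V : finType) (S : {set V}) (nu : V -> R) (A : {set V}) :
  weight_on S nu -> mass nu A <= 1.
Proof.
by move=> nuS; have [nu0 _ _] := nuS; have := massC (~: A) nuS; rewrite setCK;
  have := mass_ge0 (~: A) nu0; lra.
Qed.

Lemma mass_gt0 (R : realFieldType) (V : finType) (S : {set V}) (nu : V -> R) (A : {set V}) :
  weight_on S nu -> 0 < mass nu A -> exists2 x, x \in A & x \in S.
Proof.
move=> [nu0 nuS _] A0; apply: contrapT => nx.
suff A00 : mass nu A = 0 by rewrite A00 ltxx in A0.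
rewrite /mass big1 // => x xA; apply: nuS; apply/negP => xS.
by apply: nx; exists x.
Qed.

Lemma card_ge_mass (R : realFieldType) (V : finType) (nu : V -> R) (m : nat) (A : {set V}) :
  (forall x, nu x <= m%:R^-1) -> (0 < m)%N -> mass nu A * m%:R <= #|A|%:R.
Proof.
move=> num m0; have m0' : 0 < m%:R :> R by rewrite ltr0n.
have : mass nu A <= m%:R^-1 *+ #|A| by rewrite -sumr_const; apply: ler_sum.
move=> /(ler_wpM2r (ltW m0'))/le_trans; apply.
by rewrite mulrnAl mulVf ?gt_eqF.
Qed.

Definition undominated (R : realFieldType) (T : digraph) (S : {set T}) (nu : T -> R) : {set T} :=
  [set w in S | mass nu [set v | darc v w] <= 1 / 2].

(* Removing from [S] the vertices that [nu] fails to dominate by a strict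
   majority leaves a set in which any two vertices have a common in-neighbour in
   [S].  If few vertices are removed each time, this goes on for [k] rounds. *)
Lemma peel (R : realFieldType) (D T : digraph) (l : D -> nat) (k m : nat) (S : {set T}) :
  is_level l -> out_le2 D -> (0 < m)%N -> S != set0 -> (k * m <= #|S|)%N ->
  ~ maps_below l k S ->
  exists2 S' : {set T}, S' != set0 &
    forall nu : T -> R, weight_on S' nu -> (m <= #|undominated S' nu|)%N.
Proof.
move=> lE out2 m0; elim: k S => [|k IHk] S S0 kS nmap.
  by case: nmap; apply: maps_below0.
have [|/existsNP[nu /not_implyP[nuS /negP]]] := pselect
  (forall nu : T -> R, weight_on S nu -> (m <= #|undominated S nu|)%N); first by exists S.
rewrite -ltnNge => small; pose S' := S :\: undominated S nu.
have S'S : S' \subset S by apply: subsetDl.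
have cS' : (k * m <= #|S'|)%N.
  have := cardsID (undominated S nu) S; rewrite -/S'.
  have := subset_leq_card (subsetIr S (undominated S nu)).
  by move: kS; rewrite mulSn; lia.
have dom y : y \in S' -> 1 / 2 < mass nu [set v | darc v y].
  by rewrite !inE negb_and -ltNge => /andP[/orP[/negPf->|]].
have cov : covers_pairs S S'.
  (* Two in-neighbourhoods of weight more than one half must meet. *)
  move=> y z /dom hy /dom hz.
  have [|x] := mass_gt0 (A := [set v | darc v y] :&: [set v | darc v z]) nuS.
    have := massUI nu [set v | darc v y] [set v | darc v z].
    have := mass_le1 ([set v | darc v y] :|: [set v | darc v z]) nuS.
    by lra.
  by rewrite !inE => xyz xS; exists x.
have [S'0|S'0] := eqVneq S' set0.
  have k0 : k = 0%N by move: cS'; rewrite S'0 cards0; case: (k) => //= *; lia.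
  case: nmap; rewrite k0; apply: (maps_below_step lE out2 S0 S'S cov).
  by have [t _] := set0Pn _ S0; exists (fun=> t).
apply: (IHk S') => // map'; apply: nmap.
exact: (maps_below_step lE out2 S0 S'S cov).
Qed.

(** * Minimax by regret matching *)

Lemma mass_exchange (R : realFieldType) (T : digraph) (lam nu : T -> R) :
  \sum_v lam v * mass nu [set w | ~~ darc v w] =
  \sum_w nu w * mass lam [set v | ~~ darc v w].
Proof.
have E (f g : T -> R) (e : rel T) : \sum_v f v * mass g [set w | e v w] =
    \sum_v \sum_w (if e v w then f v * g w else 0).
  apply: eq_bigr => v _; rewrite /mass mulr_sumr big_mkcond /=.
  by apply: eq_bigr => w _; rewrite inE.
rewrite (E lam nu (fun v w => ~~ darc v w)) (E nu lam (fun w v => ~~ darc v w)).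
rewrite exchange_big; apply: eq_bigr => w _; apply: eq_bigr => v _.
by rewrite mulrC.
Qed.

(* Regret matching: [lam] puts weight on the vertices that are not yet beaten
   half of the time, in proportion to their deficit, and the answer is uniform
   on [m] vertices that [lam] fails to dominate.  The deficits and the answer
   have nonpositive correlation, so the square of the deficit vector grows at
   most linearly. *)
Lemma regret_matching (R : realFieldType) (T : digraph) (S : {set T}) (m : nat) (t : nat) :
  (0 < m)%N -> S != set0 ->
  (forall lam : T -> R, weight_on S lam -> (m <= #|undominated S lam|)%N) ->
  exists c : T -> R,
  [/\ forall x, 0 <= c x <= t%:R / m%:R, forall x, x \notin S -> c x = 0,
      \sum_x c x = t%:R &
      \sum_(v in S) Num.max 0 (t%:R / 2 - mass c [set w | ~~ darc v w]) ^+ 2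
        <= t%:R * #|S|%:R].
Proof.
move=> m0 /set0Pn[v0 v0S] und; have m0' : 0 < m%:R :> R by rewrite ltr0n.
elim: t => [|t [c [c0 cS csum cpot]]].
  exists (fun=> 0); split=> [x|//||]; first by rewrite mul0r lexx.
    by rewrite big1.
  rewrite big1 ?mul0r // => v _; rewrite /mass big1 // subr0 maxxx.
  by rewrite expr0n.
(* The deficit of [v] after [t] rounds: [c] accumulates the answers, and half of the total [t] is
   wanted outside the out-neighbourhood of [v]. *)
pose q v := t%:R / 2 - mass c [set w | ~~ darc v w].
pose P v := Num.max 0 (q v).
have P0 v : 0 <= P v by rewrite /P le_max lexx.
pose L := \sum_(v in S) P v.
have L0 : 0 <= L by apply: sumr_ge0.
have [lam lamS lamP] : exists2 lam, weight_on S lam &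
    forall v, v \in S -> P v = L * lam v.
  have [Lz|Lnz] := eqVneq L 0.
    exists (fun v => (v == v0)%:R).
      split=> [x|x xS|]; first exact: ler0n.
        by case: eqVneq xS => // ->; rewrite v0S.
      by rewrite (bigD1 v0) //= eqxx big1 ?addr0 // => x /negPf->.
    move=> v vS; rewrite Lz mul0r; apply/eqP; rewrite eq_le P0 andbT.
    by rewrite -Lz /L (bigD1 v) //= lerDl; apply: sumr_ge0.
  exists (fun v => if v \in S then P v / L else 0).
    split=> [x|x /negPf->//|]; first by case: ifP => // _; rewrite divr_ge0.
    by rewrite -big_mkcond -mulr_suml divff.
  by move=> v vS; rewrite vS mulrC divfK.
have [lam0 lamS0 lam1] := lamS.
have [E [Esub cE]] : exists E : {set T}, E \subset undominated S lam /\ #|E| = m.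
  have /card_geqP[s [us <- sub]] := und lam lamS; exists [set x in s].
  by split; [apply/subsetP => x; rewrite inE => /sub | rewrite cardsE; apply/card_uniqP].
pose nu w : R := if w \in E then m%:R^-1 else 0.
have EP w : w \in E -> (w \in S) && (mass lam [set v | darc v w] <= 1 / 2).
  by move/(subsetP Esub); rewrite inE.
have nu0 x : 0 <= nu x by rewrite /nu; case: ifP => // _; rewrite invr_ge0 ltW.
have num x : nu x <= m%:R^-1 by rewrite /nu; case: ifP; rewrite // invr_ge0 ltW.
have nu1 : \sum_x nu x = 1.
  by rewrite -big_mkcond sumr_const cE -[_ *+ m]mulr_natl divff ?gt_eqF.
pose d v := 1 / 2 - mass nu [set w | ~~ darc v w].
have corr : \sum_(v in S) P v * d v <= 0.
  have -> : \sum_(v in S) P v * d v = L * \sum_v lam v * d v.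
    rewrite mulr_sumr [RHS](bigID (mem S)) /= [X in _ + X]big1 ?addr0.
      by apply: eq_bigr => v vS; rewrite lamP // mulrA.
    by move=> v vS; rewrite lamS0 // mul0r mulr0.
  apply: mulr_ge0_le0 => //.
  rewrite /d; under eq_bigr do rewrite mulrBr.
  rewrite sumrB -mulr_suml lam1 mass_exchange subr_le0.
  rewrite -[X in X * _ <= _]nu1 mulr_suml; apply: ler_sum => w _.
  rewrite /nu; case: ifP => [/EP/andP[_ wle]|_]; last by rewrite !mul0r.
  rewrite ler_pM2l ?invr_gt0 //.
  have := massC [set v | darc v w] lamS.
  by rewrite (_ : ~: _ = [set v | ~~ darc v w]); [lra | apply/setP => v; rewrite !inE].
exists (fun x => c x + nu x); split=> [x|x xS||].
- have /andP[cx0 cxt] := c0 x; rewrite addr_ge0 //= -natr1 mulrDl mul1r.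
  exact: lerD.
- rewrite cS // add0r /nu; case: ifP => // /EP/andP[xS' _].
  by rewrite xS' in xS.
- by rewrite big_split /= csum nu1 natr1.
have mass1 v : 0 <= mass nu [set w | ~~ darc v w] <= 1.
  rewrite mass_ge0 //=; apply: (@mass_le1 _ _ S); split=> // x xS.
  by rewrite /nu; case: ifP => // /EP/andP[xS' _]; rewrite xS' in xS.
(* One round changes the deficit by [d v], at most 1 in absolute value, so its squared positive part
   grows by at most 1 besides the cross term that [corr] controls. *)
have sq v : Num.max 0 (t.+1%:R / 2 - mass (fun x => c x + nu x) [set w | ~~ darc v w]) ^+ 2
    <= P v ^+ 2 + (P v * d v) * 2 + 1.
  have -> : t.+1%:R / 2 - mass (fun x => c x + nu x) [set w | ~~ darc v w] = q v + d v.
    by rewrite /mass big_split /= -natr1 /q /d /mass; field.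
  have qP : q v <= P v by rewrite /P le_max lexx orbT.
  have d1 : -1 <= d v <= 1 by have := mass1 v; rewrite /d; lra.
  have dd : 0 <= (1 - d v) * (1 + d v) by rewrite mulr_ge0 //; lra.
  have le_sq : P v ^+ 2 + P v * d v * 2 + 1 = (P v + d v) ^+ 2 + (1 - d v) * (1 + d v).
    by ring.
  rewrite le_sq -[leLHS]addr0; apply: lerD => //.
  case: (leP 0 (q v + d v)) => h; last by rewrite expr0n /= sqr_ge0.
  by rewrite ler_sqr ?nnegrE; lra.
apply: le_trans (ler_sum _ (fun v _ => sq v)) _.
rewrite !big_split /= -mulr_suml sumr_const -[t.+1%:R]natr1 mulrDl mul1r.
move: cpot corr; rewrite /P /q /=; lra.
Qed.

(** The weight is the average answer over [t] rounds. Each deficit is at most the square root of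
    [t * #|S|], hence at most [eps * t] once [t >= #|S| / eps ^ 2]. *)
Lemma balanced_weight (R : archiRealFieldType) (T : digraph) (S : {set T}) (m : nat) (eps : R) :
  tournament T -> (0 < m)%N -> S != set0 -> 0 < eps ->
  (forall lam : T -> R, weight_on S lam -> (m <= #|undominated S lam|)%N) ->
  exists nu : T -> R, [/\ weight_on S nu, forall x, nu x <= m%:R^-1 &
    {in S, forall v, 1 / 2 - eps - m%:R^-1 <= mass nu [set w | darc w v]}].
Proof.
move=> tT m0 S0 eps0 und; pose x : R := #|S|%:R / eps ^+ 2.
have x0 : 0 <= x by rewrite divr_ge0 // sqr_ge0.
have [t t0 tx] : exists2 t : nat, 0 < t%:R :> R & x <= t%:R.
  exists (Num.bound x); last exact/ltW/Num.Theory.archi_boundP.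
  exact: le_lt_trans (Num.Theory.archi_boundP x0).
have [c [c0 cS csum cpot]] := regret_matching t m0 S0 und.
pose nu x := c x / t%:R.
have nu_mass A : mass nu A * t%:R = mass c A.
  by rewrite /mass /nu -mulr_suml divfK ?gt_eqF.
have num y : nu y <= m%:R^-1.
  by rewrite /nu ler_pdivrMr // [_^-1 * _]mulrC; have /andP[_ ->] := c0 y.
have nuS : weight_on S nu.
  split=> [y|y yS|]; first by have /andP[c0y _] := c0 y; apply: divr_ge0 c0y (ltW t0).
    by rewrite /nu cS ?mul0r.
  by rewrite -mulr_suml csum divff ?gt_eqF.
exists nu; split; [exact: nuS | exact: num | move=> v vS].
pose q := t%:R / 2 - mass c [set w | ~~ darc v w].
have qle : q <= eps * t%:R.
  have le1 : Num.max 0 q ^+ 2 <= t%:R * #|S|%:R.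
    apply: le_trans cpot; rewrite (bigD1 v) //= lerDl.
    by apply: sumr_ge0 => w _; rewrite sqr_ge0.
  have le2 : #|S|%:R <= t%:R * eps ^+ 2 by rewrite -ler_pdivrMr // exprn_gt0.
  have le3 : Num.max 0 q ^+ 2 <= (eps * t%:R) ^+ 2.
    apply: le_trans le1 _; have -> : (eps * t%:R) ^+ 2 = t%:R * (t%:R * eps ^+ 2) by ring.
    by rewrite ler_pM2l.
  have : Num.max 0 q <= eps * t%:R.
    by rewrite -ler_sqr ?nnegrE ?le_max ?lexx // mulr_ge0 ?ltW.
  by rewrite ge_max => /andP[].
have half : 1 / 2 - eps <= mass nu [set w | ~~ darc v w].
  by rewrite -(ler_pM2r t0) nu_mass; move: qle; rewrite /q; lra.
(* Passing from non-out-neighbours to in-neighbours loses only [v] itself, of weight at most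
   [1 / m]. *)
have sub : mass nu [set w | ~~ darc v w] <= nu v + mass nu [set w | darc w v].
  have [nu0 _ _] := nuS; have -> : nu v = mass nu [set v] by rewrite /mass big_set1.
  apply: le_trans (massU_le [set v] _ nu0); apply: mass_sub => //.
  apply/subsetP => w; rewrite !inE; case: eqVneq => //= wv vw.
  by apply: tour_conn; rewrite // eq_sym.
by have := num v; lra.
Qed.

(** * Random samples *)

Lemma sample_avoids (R : realFieldType) (V : finType) (nu : V -> R) (C : V -> V -> {set V})
    (r : nat) (i j : 'I_r) : \sum_x nu x = 1 -> i != j ->
  \sum_(f : {ffun 'I_r -> V}) \prod_k nu (f k) *
     [forall k, (k != i) && (k != j) ==> (f k \notin C (f i) (f j))]%:R =
  \sum_x \sum_y nu x * nu y * (1 - mass nu (C x y)) ^+ (r - 2).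
Proof.
move=> nu1 ij.
(* Coordinates [i] and [j] are pinned to [x] and [y], and the other [r - 2] avoid [C x y]
   independently. For a given sample [f] only the term [(x, y) = (f i, f j)] survives. *)
pose G x y k z := nu z * (if k == i then z == x else
  if k == j then z == y else z \notin C x y)%:R.
have GE x y : nu x * nu y * (1 - mass nu (C x y)) ^+ (r - 2) =
    \prod_k \sum_z G x y k z.
  have ji : j != i by rewrite eq_sym.
  have one w : \sum_z nu z * (z == w)%:R = nu w.
    rewrite (bigD1 w) //= eqxx mulr1 big1 ?addr0 // => z /negPf->.
    by rewrite mulr0.
  rewrite (bigD1 i) //= (bigD1 j) //= /G eqxx (negPf ji) eqxx !one mulrA.
  congr (_ * _); rewrite (eq_bigr (fun=> 1 - mass nu (C x y))); last first.
    move=> k /andP[/negPf-> /negPf->]; rewrite -[X in _ = X - _]nu1 /mass [X in _ = _ - X]big_mkcond -sumrB /=.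
    by apply: eq_bigr => z _; case: ifP; rewrite ?mulr0 ?mulr1 ?subrr ?subr0.
  rewrite prodr_const; congr (_ ^+ _).
  have := cardC (pred2 i j); rewrite card2 ij card_ord => rE.
  rewrite -[in LHS]rE addKn; apply: eq_card => k; by rewrite !inE negb_or.
under [RHS]eq_bigr do under eq_bigr do rewrite GE bigA_distr_bigA /=.
rewrite pair_big exchange_big /=; apply: eq_bigr => f _.
rewrite (bigD1 (f i, f j)) //= [X in _ + X]big1 ?addr0 => [|[x y]].
  rewrite /G big_split /=; congr (_ * _).
  have ji : j != i by rewrite eq_sym.
  case: forallP => [av|nav].
    rewrite big1 // => k _; case: eqVneq => [->|ki]; first by rewrite eqxx.
    case: eqVneq => [->|kj]; first by rewrite eqxx.
    by have := av k; rewrite ki kj /= => ->.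
  have /existsP[k] : [exists k, ~~ ((k != i) && (k != j) ==> (f k \notin C (f i) (f j)))].
    by rewrite -negb_forall; apply/forallP.
  rewrite negb_imply => /andP[/andP[/negPf ki /negPf kj] /negPf nk].
  by rewrite (bigD1 k) //= ki kj nk mul0r.
rewrite xpair_eqE negb_and /= => /orP[/negPf fx|/negPf fy].
  by rewrite (bigD1 i) //= /G eqxx eq_sym fx mulr0 mul0r.
by rewrite (bigD1 j) //= /G eqxx [j == i]eq_sym (negPf ij) eq_sym fy mulr0 mul0r.
Qed.

Definition common_in (T : digraph) (x y : T) : {set T} :=
  [set z | darc z x && darc z y].

(* A random sample of [r] vertices is never closed under taking common
   in-neighbours, so by the union bound some pair of sampled vertices often has
   few common in-neighbours. *)
Lemma poor_pairs_dense (R : realFieldType) (T : digraph) (S : {set T}) (nu : T -> R) (delta : R)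
    (r : nat) : weight_on S nu -> (2 <= r)%N -> 0 <= delta <= 1 ->
  (forall Y : {set T}, Y != set0 -> ~ covers_pairs Y Y) ->
  1 <= r%:R ^+ 2 * (\sum_x nu x * mass nu [set y | mass nu (common_in x y) <= delta]
                     + (1 - delta) ^+ (r - 2)).
Proof.
move=> nuS r2 delta01 nclosed; have [nu0 _ nu1] := nuS.
set B := (X in _ * X).
pose bad i j (f : {ffun 'I_r -> T}) : R :=
  [forall k, (k != i) && (k != j) ==> (f k \notin common_in (f i) (f j))]%:R.
(* Either the sampled pair is poor, or its common in-neighbours weigh more than [delta] and the
   other [r - 2] points miss them with probability at most [(1 - delta) ^ (r - 2)]. *)
have badle i j : i != j -> \sum_(f : {ffun 'I_r -> T}) \prod_k nu (f k) * bad i j f <= B.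
  move=> ij; rewrite (sample_avoids (@common_in T) nu1 ij).
  have -> : B = \sum_x \sum_y nu x * nu y *
      ((y \in [set y | mass nu (common_in x y) <= delta])%:R + (1 - delta) ^+ (r - 2)).
    transitivity (\sum_x nu x *
        (mass nu [set y | mass nu (common_in x y) <= delta] + (1 - delta) ^+ (r - 2))).
      by under [RHS]eq_bigr do rewrite mulrDr; rewrite big_split -mulr_suml nu1 mul1r.
    apply: eq_bigr => x _; under [RHS]eq_bigr do rewrite -mulrA mulrDr.
    rewrite -mulr_sumr big_split -mulr_suml nu1 mul1r /mass big_mkcond /=.
    by congr (_ * (_ + _)); apply: eq_bigr => y _; case: ifP; rewrite ?mulr1 ?mulr0.
  apply: ler_sum => x _; apply: ler_sum => y _.
  rewrite ler_wpM2l ?mulr_ge0 // inE.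
  have m1 := mass_le1 (common_in x y) nuS; have m0 := mass_ge0 (common_in x y) nu0.
  case: (leP (mass nu (common_in x y)) delta) => h /=.
    have : 0 <= (1 - delta) ^+ (r - 2) by rewrite exprn_ge0 //; lra.
    have : (1 - mass nu (common_in x y)) ^+ (r - 2) <= 1 by rewrite exprn_ile1 //; lra.
    by lra.
  by rewrite add0r lerXn2r ?nnegrE //; lra.
have all1 : \sum_(f : {ffun 'I_r -> T}) \prod_k nu (f k) = 1.
  by rewrite -(bigA_distr_bigA (fun=> nu)) big1.
have P0 f : 0 <= \prod_k nu (f k) by apply: prodr_ge0.
have cover f : 1 <= \sum_i \sum_(j | j != i) bad i j f.
  pose Y := [set f i | i in [set: 'I_r]].
  have fY i : f i \in Y by apply: imset_f.
  have Y0 : Y != set0 by apply/set0Pn; exists (f (Ordinal (ltnW r2))).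
  have [i [j [ij bij]]] : exists i j, j != i /\ bad i j f = 1.
    have /existsNP[y /existsNP[z /not_implyP[yY /not_implyP[zY nyz]]]] := nclosed Y Y0.
    have [i _ yE] := imsetP yY; have [j' _ zE] := imsetP zY.
    have noC k : f k \notin common_in (f i) (f j').
      by apply/negP; rewrite inE -yE -zE => h; apply: nyz; exists (f k).
    (* If the uncovered pair is one vertex taken twice, any second index [j] serves: a common
       in-neighbour of [f i] and [f j] is an in-neighbour of [f i]. *)
    have [E|ij] := eqVneq j' i; last first.
      by exists i, j'; split=> //; rewrite /bad; case: forallP => // -[k]; rewrite noC implybT.
    have [j ij] : exists j : 'I_r, j != i.
      case: (eqVneq i (Ordinal (ltnW r2))) => [->|]; last first.
        by rewrite eq_sym; exists (Ordinal (ltnW r2)).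
      by exists (Ordinal r2).
    exists i, j; split=> //; rewrite /bad; case: forallP => // -[k].
    apply/implyP => _; have := noC k; rewrite E; apply: contra.
    by rewrite !inE => /andP[-> _].
  rewrite (bigD1 i) //= (bigD1 j) //= bij -addrA lerDl addr_ge0 //.
    by apply: sumr_ge0 => ? _; rewrite /bad ler0n.
  by apply: sumr_ge0 => ? _; apply: sumr_ge0 => ? _; rewrite /bad ler0n.
have B0 : 0 <= B.
  have := badle (Ordinal (ltnW r2)) (Ordinal r2) isT; apply: le_trans.
  by apply: sumr_ge0 => f _; rewrite mulr_ge0 // /bad ler0n.
apply: (@le_trans _ _ (\sum_i \sum_(j | j != i)
    \sum_(f : {ffun 'I_r -> T}) \prod_k nu (f k) * bad i j f)).
  have -> : \sum_i \sum_(j | j != i)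
      \sum_(f : {ffun 'I_r -> T}) \prod_k nu (f k) * bad i j f =
    \sum_(f : {ffun 'I_r -> T}) \prod_k nu (f k) * \sum_i \sum_(j | j != i) bad i j f.
    transitivity (\sum_(f : {ffun 'I_r -> T}) \sum_i \sum_(j | j != i)
        \prod_k nu (f k) * bad i j f).
      by rewrite [RHS]exchange_big; apply: eq_bigr => i _; rewrite exchange_big.
    apply: eq_bigr => f _; rewrite mulr_sumr; apply: eq_bigr => i _.
    by rewrite mulr_sumr.
  by rewrite -[leLHS]all1; apply: ler_sum => f _; rewrite ler_peMr.
apply: (@le_trans _ _ (\sum_(i < r) \sum_(j < r) B)); last first.
  by rewrite !sumr_const !card_ord -[_ *+ r]mulr_natl -[B *+ r]mulr_natl mulrA expr2.
apply: ler_sum => i _; rewrite [leRHS](bigID (fun j => j != i)) /= -[leLHS]addr0.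
apply: lerD; last by apply: sumr_ge0.
by apply: ler_sum => j ji; apply: badle; rewrite eq_sym.
Qed.

Lemma sample_size_exists (R : archiRealFieldType) (delta : R) : 0 < delta < 1 ->
  exists2 r, (2 <= r)%N & r%:R ^+ 2 * (1 - delta) ^+ (r - 2) <= 1 / 2.
Proof.
(* With [r = 3 * k + 2] and [y = (1 - delta) ^ k], the bound [y * k * delta <= 1] gives
   [r ^ 2 * y ^ 3 <= 25 / (k * delta ^ 3)], which is below one half when [k * delta ^ 3 > 50]. *)
move=> /andP[d0 d1]; pose x : R := 50 / delta ^+ 3.
have x0 : 0 <= x by rewrite divr_ge0 // exprn_ge0 // ltW.
have [k xk] : exists k : nat, x < k%:R by exists (Num.bound x); apply: Num.Theory.archi_boundP.
have k0 : (0 < k)%N by rewrite -(ltr_nat R); apply: (le_lt_trans x0 xk).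
exists (3 * k + 2)%N; first by rewrite leq_addl.
rewrite addnK mulnC exprM; set y := (1 - delta) ^+ k.
have y0 : 0 <= y by rewrite exprn_ge0 // subr_ge0 ltW.
have ya : y * (k%:R * delta) <= 1.
  rewrite /y; elim: (k) => [|n IHn]; first by rewrite mul0r mulr0.
  have z0 : 0 <= (1 - delta) ^+ n by rewrite exprn_ge0 // subr_ge0 ltW.
  have z1 : (1 - delta) ^+ n <= 1 by rewrite exprn_ile1 //; lra.
  rewrite exprS -natr1; set z := _ ^+ n in IHn z0 z1 *.
  have -> : (1 - delta) * z * ((n%:R + 1) * delta) =
    (1 - delta) * (z * (n%:R * delta)) + (1 - delta) * delta * z by ring.
  have : (1 - delta) * (z * (n%:R * delta)) <= (1 - delta) * 1.
    by rewrite ler_wpM2l //; lra.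
  have : (1 - delta) * delta * z <= delta * 1.
    by apply: ler_pM => //; nra.
  by lra.
have xk' : 50 < k%:R * delta ^+ 3 by rewrite -ltr_pdivrMr // exprn_gt0.
have kR : 1 <= k%:R :> R by rewrite ler1n.
have y3 : y ^+ 3 * (k%:R * delta) ^+ 3 <= 1.
  rewrite -exprMn exprn_ile1 // mulr_ge0 //; nra.
have r5 : ((k * 3 + 2)%N%:R : R) ^+ 2 <= 25 * k%:R ^+ 2.
  by rewrite natrD natrM; nra.
have y30 : 0 <= y ^+ 3 by rewrite exprn_ge0.
apply: le_trans (ler_wpM2r y30 r5) _.
have : 25 * k%:R ^+ 2 * y ^+ 3 * (k%:R * delta ^+ 3) <= 25.
  by move: y3; rewrite exprMn; lra.
have : 25 * k%:R ^+ 2 * y ^+ 3 * 50 <= 25 * k%:R ^+ 2 * y ^+ 3 * (k%:R * delta ^+ 3).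
  apply: ler_wpM2l (ltW xk'); apply: mulr_ge0 => //; apply: mulr_ge0; first lra.
  by apply: exprn_ge0; lra.
by lra.
Qed.

(** * Nearly complementary in-neighbourhoods *)

Definition inn (T : digraph) (v : T) : {set T} := [set w | darc w v].
Definition outn (T : digraph) (v : T) : {set T} := [set w | darc v w].

Lemma arc_mass_exchange (R : realFieldType) (T : digraph) (nu : T -> R) (K M : {set T}) :
  \sum_(z in M) nu z * mass nu (inn z :&: K) =
  \sum_(b in K) nu b * mass nu (outn b :&: M).
Proof.
have E (A B : {set T}) (e : rel T) :
    \sum_(x in A) nu x * mass nu ([set w | e x w] :&: B) =
    \sum_(x in A) \sum_(y in B) (if e x y then nu x * nu y else 0).
  apply: eq_bigr => x _; rewrite /mass mulr_sumr -big_mkcondr.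
  by apply: eq_bigl => y; rewrite !inE andbC.
rewrite (E M K (fun z w => darc w z)) (E K M (fun b w => darc b w)) exchange_big.
by apply: eq_bigr => b _; apply: eq_bigr => z _; rewrite mulrC.
Qed.

(** Exchanging the sums turns one copy into out-neighbours, and [inn z] and [outn z] are
    disjoint. *)
Lemma inner_arc_mass (R : realFieldType) (T : digraph) (nu : T -> R) (M : {set T}) :
  tournament T -> (forall x, 0 <= nu x) ->
  2 * \sum_(z in M) nu z * mass nu (inn z :&: M) <= mass nu M ^+ 2.
Proof.
move=> tT nu0; rewrite mulr_natl mulr2n {2}arc_mass_exchange -big_split /=.
rewrite expr2 {2}/mass mulr_suml; apply: ler_sum => z _.
rewrite -mulrDr ler_wpM2l //.
have I0 : inn z :&: M :&: (outn z :&: M) = set0.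
  apply/setP => w; rewrite !inE; apply/negbTE; rewrite !negb_and.
  by have [/(tour_asym tT)->|] := boolP (darc w z); rewrite ?orbT.
rewrite -massUI I0 [X in _ + X]big_set0 addr0; apply: mass_sub => //.
by rewrite subUset !subsetIr.
Qed.

(* The vertices [a1], [a2], [a3] share almost no in-neighbour with [u], so their
   in-neighbourhoods all nearly coincide with the complement of that of [u].
   Hence [K] and [M] both weigh nearly one half, and since vertices of [M] receive
   half of the weight while [M] can provide only a quarter, many arcs go from [K]
   to [M]. *)
Lemma near_twins_dense (R : realFieldType) (T : digraph) (S : {set T})
    (nu : T -> R) (u a1 a2 a3 : T) (K := outn a1 :&: outn a2 :&: outn a3)
    (M := inn a1 :&: inn a2 :&: inn a3) : tournament T -> weight_on S nu ->
  (forall x, nu x <= 1 / 1000) ->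
  {in S, forall v, 1 / 2 - 1 / 500 <= mass nu (inn v)} ->
  u \in S -> a1 \in S -> a2 \in S -> a3 \in S ->
  mass nu (common_in u a1) <= 1 / 200 -> mass nu (common_in u a2) <= 1 / 200 ->
  mass nu (common_in u a3) <= 1 / 200 ->
  3 / 40 <= \sum_(b in K) nu b * mass nu (outn b :&: M).
Proof.
move=> tT nuS num half uS a1S a2S a3S c1 c2 c3; have [nu0 nuS0 nu1] := nuS.
have halfu := half u uS; have half1 := half a1 a1S.
have half2 := half a2 a2S; have half3 := half a3 a3S.
have mass1 x : mass nu [set x] = nu x by rewrite /mass big_set1.
have le2 (A B C : {set T}) : A \subset B :|: C -> mass nu A <= mass nu B + mass nu C.
  by move=> sub; apply: le_trans (mass_sub nu0 sub) (massU_le _ _ nu0).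
have far a : a \in S -> mass nu (common_in u a) <= 1 / 200 ->
    mass nu (inn u :\: outn a) <= 1 / 200 + 1 / 1000.
  move=> aS ca; have := le2 (inn u :\: outn a) (common_in u a) [set a].
  have sub : inn u :\: outn a \subset common_in u a :|: [set a].
    apply/subsetP => w; rewrite !inE => /andP[aw wu]; rewrite wu /=.
    by case: (eqVneq w a) => //= wa; rewrite ?orbT // orbF; apply: tour_conn; rewrite // eq_sym.
  by move=> /(_ sub); rewrite mass1; have := num a; lra.
have near a b : a \in S -> b \in S -> mass nu (common_in u a) <= 1 / 200 ->
    mass nu (common_in u b) <= 1 / 200 ->
    mass nu (inn a :\: inn b) <= 1 / 200 + 1 / 200 + 1 / 250.
  move=> aS bS ca cb.
  have sub : inn a :\: inn b \subset common_in u a :|: ~: (inn u :|: inn b).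
    apply/subsetP => w; rewrite !inE => /andP[/negPf wb ->]; rewrite wb orbF andbT.
    exact: orbN.
  have := le2 _ _ _ sub; rewrite (massC _ nuS).
  have := massUI nu (inn u) (inn b).
  rewrite (_ : inn u :&: inn b = common_in u b); last by apply/setP => w; rewrite !inE.
  by have := half b bS; lra.
have K9 : 9 / 20 <= mass nu K.
  have sub : inn u \subset K :|: (inn u :\: outn a1) :|:
      ((inn u :\: outn a2) :|: (inn u :\: outn a3)).
    apply/subsetP => w; rewrite !inE => ->; rewrite !andbT.
    by case: (darc a1 w); case: (darc a2 w); case: (darc a3 w).
  have h1 := le2 _ _ _ sub.
  have h2 := massU_le K (inn u :\: outn a1) nu0.
  have h3 := massU_le (inn u :\: outn a2) (inn u :\: outn a3) nu0.
  by have f1 := far a1 a1S c1; have f2 := far a2 a2S c2; have f3 := far a3 a3S c3; lra.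
have M9 : 9 / 20 <= mass nu M.
  have sub : inn a1 \subset M :|: ((inn a1 :\: inn a2) :|: (inn a1 :\: inn a3)).
    apply/subsetP => w; rewrite !inE => ->; rewrite !andbT /=.
    by case: (darc w a2); case: (darc w a3).
  have h1 := le2 _ _ _ sub.
  have h3 := massU_le (inn a1 :\: inn a2) (inn a1 :\: inn a3) nu0.
  by have n2 := near a1 a2 a1S a2S c1 c2; have n3 := near a1 a3 a1S a3S c1 c3; lra.
have KM : mass nu (K :|: M) = mass nu K + mass nu M.
  rewrite -massUI (_ : K :&: M = set0) ?[X in _ + X]big_set0 ?addr0 //.
  apply/setP => w; rewrite !inE; apply/negbTE; rewrite !negb_and.
  by have [/(tour_asym tT)->|] := boolP (darc a1 w); rewrite ?orbT.
rewrite -arc_mass_exchange; set X := \sum_(z in M) _.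
set W := \sum_(z in M) nu z * mass nu (inn z :&: M).
have W2 : 2 * W <= mass nu M ^+ 2 by apply: inner_arc_mass.
(* A vertex of [M] in [S] receives at least [1 / 2 - 1 / 500] in all; [g] is what remains for [K]
   and [M] to supply when everything outside them contributes fully. *)
pose g := mass nu K + mass nu M - 1 / 2 - 1 / 500.
have : mass nu M * g <= X + W.
  rewrite /X /W -big_split /= {1}/mass mulr_suml; apply: ler_sum => z zM.
  rewrite -mulrDr; have [zS|/nuS0->] := boolP (z \in S); last by rewrite !mul0r.
  rewrite ler_wpM2l // /g.
  have sub : inn z \subset (inn z :&: K :|: inn z :&: M) :|: ~: (K :|: M).
    by apply/subsetP => w wz; rewrite !in_setU in_setC !in_setI wz !in_setU /= !in_setI orbN.
  have h1 := le2 _ _ _ sub; have h2 := massU_le (inn z :&: K) (inn z :&: M) nu0.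
  by move: h1; rewrite (massC _ nuS) KM; have := half z zS; lra.
by rewrite /g; nra.
Qed.

Lemma mass_sub_sum (R : realFieldType) (V : finType) (nu : V -> R) (A B : {set V}) :
  A \subset B -> mass nu A = \sum_(x in B) (if x \in A then nu x else 0).
Proof.
move=> /subsetP AB; rewrite -big_mkcondr; apply: eq_bigl => x.
by apply/idP/andP => [xA|[]//]; split=> //; apply: AB.
Qed.

(* The cyclic triangles are found in turn: [a1 a2 a3] among the vertices sharing
   few in-neighbours with [u], then one among [160 * p] vertices of [K] with many
   out-neighbours in [M], and the last among its [p] common out-neighbours. *)
Lemma blowup_exists (R : realFieldType) (T : digraph) (S : {set T}) (nu : T -> R)
    (u : T) (m p : nat) : tournament T -> weight_on S nu ->
  (forall x, nu x <= m%:R^-1) ->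
  {in S, forall v, 1 / 2 - 1 / 500 <= mass nu (inn v)} ->
  (0 < p)%N -> (80 * (160 * p) ^ 3 <= m)%N ->
  (forall X : {set T}, (p <= #|X|)%N -> cyclic3 X) ->
  u \in S ->
  (p <= #|[set v in S | (mass nu (common_in u v) <= 1 / 200)%R]|)%N ->
  exists2 Y : {set T}, Y != set0 & covers_pairs Y Y.
Proof.
move=> tT nuS num half p0 mp cyc uS /cyc[a1 [a2 [a3 []]]].
rewrite !inE => /andP[a1S c1] /andP[a2S c2] /andP[a3S c3] a123.
have [nu0 _ nu1] := nuS.
have [N NE] : exists N, N = (160 * p)%N by exists (160 * p)%N.
rewrite -NE in mp; have N0 : (0 < N)%N by rewrite NE muln_gt0.
have NR : N%:R = 160 * p%:R :> R by rewrite NE natrM.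
have p1R : 1 <= p%:R :> R by rewrite ler1n.
have m80 : 80 * (N ^ 3)%:R <= m%:R :> R by rewrite -natrM ler_nat.
have N3 : N%:R <= (N ^ 3)%:R :> R by rewrite ler_nat -{1}(expn1 N) leq_pexp2l.
have m0' : 0 < m%:R :> R by lra.
have m0 : (0 < m)%N by rewrite -(ltr_nat R).
have num' x : nu x <= 1 / 1000.
  by apply: le_trans (num x) _; rewrite div1r lef_pV2 ?posrE //; lra.
have dense := near_twins_dense tT nuS num' half uS a1S a2S a3S c1 c2 c3.
set K := outn a1 :&: outn a2 :&: outn a3 in dense.
set M := inn a1 :&: inn a2 :&: inn a3 in dense.
(* The total [3 / 40] minus the threshold [1 / 40] leaves weight [1 / 20], which amounts to at least
   [N] vertices. *)
pose K1 := [set b in K | 1 / 40 <= mass nu (outn b :&: M)].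
have K1mass : 1 / 20 <= mass nu K1.
  suff : \sum_(b in K) nu b * mass nu (outn b :&: M) <= mass nu K1 + 1 / 40 by lra.
  rewrite (@mass_sub_sum _ _ nu K1 K); last first.
    by apply/subsetP => b; rewrite inE => /andP[].
  apply: (@le_trans _ _ (\sum_(b in K) ((if b \in K1 then nu b else 0) + nu b * (1 / 40)))).
    apply: ler_sum => b bK; rewrite inE bK /=; have b0 := nu0 b.
    have m1 := mass_le1 (outn b :&: M) nuS.
    case: (leP (1 / 40) (mass nu (outn b :&: M))) => h.
      have : nu b * mass nu (outn b :&: M) <= nu b * 1 by rewrite ler_wpM2l.
      by lra.
    by rewrite add0r ler_wpM2l // ltW.
  rewrite big_split lerD2l -mulr_suml /=; have := mass_le1 K nuS.
  by rewrite /mass; lra.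
have /card_geqP[s [us ss sK]] : (N <= #|K1|)%N.
  rewrite -(ler_nat R); apply: le_trans (card_ge_mass K1 num m0).
  have : 1 / 20 * m%:R <= mass nu K1 * m%:R by rewrite ler_wpM2r // ltW.
  by lra.
pose K0 := [set b in s]; have cK0 : #|K0| = N by rewrite cardsE -ss; apply/card_uniqP.
have K0P b : b \in K0 -> b \in K /\ 1 / 40 <= mass nu (outn b :&: M).
  by rewrite inE => /sK; rewrite inE => /andP[].
pose dg z := #|[set b in K0 | darc b z]|.
(* The [160 * p] vertices of [K0] send at least [160 * p / 40 = 4 * p] in total. Vertices of degree
   below [2 * p] absorb at most [2 * p], so [Z] weighs at least [2 * p / (160 * p) = 1 / 80]. *)
pose Z := [set z in M | (2 * p <= dg z)%N].
have dgN z : (dg z <= N)%N.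
  rewrite -cK0; apply/subset_leq_card/subsetP => b.
  by rewrite inE => /andP[].
have Zmass : 1 / 80 <= mass nu Z.
  have low : 4 * p%:R <= \sum_(z in M) nu z * (dg z)%:R.
    have -> : \sum_(z in M) nu z * (dg z)%:R = \sum_(b in K0) mass nu (outn b :&: M).
      transitivity (\sum_(z in M) \sum_(b in K0) (if darc b z then nu z else 0)).
        apply: eq_bigr => z _; rewrite /dg -big_mkcondr /= mulr_natr -sumr_const.
        by apply: eq_bigl => b; rewrite !inE.
      rewrite exchange_big; apply: eq_bigr => b _; rewrite -big_mkcondr.
      by apply: eq_bigl => z; rewrite !inE andbC.
    apply: (@le_trans _ _ (\sum_(b in K0) 1 / 40)).
      by rewrite sumr_const cK0 -[_ *+ N]mulr_natl NR; lra.
    by apply: ler_sum => b /K0P[].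
  have up : \sum_(z in M) nu z * (dg z)%:R <= mass nu Z * N%:R + 2 * p%:R.
    rewrite (@mass_sub_sum _ _ nu Z M); last first.
      by apply/subsetP => z; rewrite inE => /andP[].
    apply: (@le_trans _ _ (\sum_(z in M)
        ((if z \in Z then nu z else 0) * N%:R + nu z * (2 * p%:R)))).
      apply: ler_sum => z zM; rewrite inE zM /=; have z0 := nu0 z.
      case: leqP => h.
        rewrite -[leLHS]addr0; apply: lerD; last by rewrite mulr_ge0 // mulr_ge0.
        by rewrite ler_wpM2l // ler_nat.
      by rewrite mul0r add0r ler_wpM2l // -natrM ler_nat ltnW.
    rewrite big_split -!mulr_suml /= lerD2l.
    have := mass_le1 M nuS; rewrite /mass => M1.
    by rewrite -[leRHS]mul1r ler_wpM2r // mulr_ge0.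
  suff : 2 * p%:R <= mass nu Z * 160 * p%:R by nra.
  by move: low up; rewrite NR; lra.
have cZ : (N ^ 3 <= #|Z|)%N.
  rewrite -(ler_nat R); apply: le_trans (card_ge_mass Z num m0).
  have : 1 / 80 * m%:R <= mass nu Z * m%:R by rewrite ler_wpM2r // ltW.
  by lra.
have [|||t tK] := @popular_triangle T p K0 Z cyc p0.
- by move=> z; rewrite inE => /andP[].
- by rewrite cK0.
- by apply: leq_trans cZ; rewrite expn_gt0 N0.
set Zt := [set z in Z | _] => /cyc/cyclic3_triangle[t' t'Z].
have a_tri : (a1, a2, a3) \in triangles S by rewrite inE /= a1S a2S a3S.
have BK b : b \in vertices3 t -> b \in K by move=> /(triangle_sub tK)/K0P[].
have CZ c : c \in vertices3 t' -> c \in M /\ {in vertices3 t, forall b, darc b c}.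
  move=> /(triangle_sub t'Z); rewrite [_ \in Zt]inE => /andP[cZ' /forall_inP bc].
  by move: cZ'; rewrite [_ \in Z]inE => /andP[].
have ne s' : vertices3 s' != set0 :> {set T}.
  by apply/set0Pn; exists s'.1.1; rewrite !inE eqxx.
exists (vertices3 (a1, a2, a3) :|: vertices3 t :|: vertices3 t').
  by apply: contraNneq (ne (a1, a2, a3)) => E0; rewrite -subset0 -E0 -setUA subsetUl.
apply: blowup_closed => //.
- by move=> x; apply: triangle_pred a_tri.
- by move=> x; apply: triangle_pred tK.
- by move=> x; apply: triangle_pred t'Z.
- move=> a b + /BK; rewrite !inE -!orbA -!andbA /= => h /and3P[? ? ?].
  by case/or3P: h => /eqP->.
- by move=> b c bt /CZ[_]; apply.
move=> c a /CZ[+ _]; rewrite !inE -!orbA -!andbA /= => /and3P[? ? ?].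
by case/or3P=> /eqP->.
Qed.

(** If no set were closed, some [u] would have poor partners of weight at least [1 / (4 * r ^ 2)],
    hence at least [p] of them, and the blow-up would be closed. *)
Lemma closed_exists (R : archiRealFieldType) (T : digraph) (S : {set T}) (m p r : nat) :
  tournament T -> S != set0 ->
  (forall lam : T -> R, weight_on S lam -> (m <= #|undominated S lam|)%N) ->
  (forall X : {set T}, (p <= #|X|)%N -> cyclic3 X) ->
  (0 < p)%N -> (2 <= r)%N -> r%:R ^+ 2 * (1 - 1 / 200) ^+ (r - 2) <= 1 / 2 :> R ->
  (80 * (160 * p) ^ 3 <= m)%N -> (4 * r ^ 2 * p <= m)%N ->
  exists2 Y : {set T}, Y != set0 & covers_pairs Y Y.
Proof.
move=> tT S0 und cyc p0 r2 rsmall mp mr; apply: contrapT => nclosed.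
have ncl (Y : {set T}) : Y != set0 -> ~ covers_pairs Y Y.
  by move=> Y0 cY; apply: nclosed; exists Y.
have m1000 : 1000 <= m%:R :> R.
  have p1R : 1 <= p%:R :> R by rewrite ler1n.
  have : 80 * (160 * p%:R) ^+ 3 <= m%:R :> R by rewrite -natrM -natrX -natrM ler_nat.
  have : 1 <= p%:R ^+ 3 :> R by rewrite exprn_ege1.
  by rewrite exprMn; lra.
have m0 : (0 < m)%N by rewrite -(ltr_nat R); lra.
have m0' : 0 < m%:R :> R by rewrite ltr0n.
have eps0 : 0 < 1 / 1000 :> R by lra.
have [nu [nuS num half]] := balanced_weight tT m0 S0 eps0 und.
have minv : m%:R^-1 <= 1 / 1000 :> R by rewrite div1r lef_pV2 ?posrE //; lra.
have half' : {in S, forall v, 1 / 2 - 1 / 500 <= mass nu (inn v)}.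
  by move=> v /half; rewrite -/(inn v); lra.
have [nu0 nuS0 nu1] := nuS.
have d01 : 0 <= (1 / 200 : R) <= 1 by apply/andP; split; lra.
have := poor_pairs_dense nuS r2 d01 ncl.
set poor := \sum_x _ => dense.
have r0 : 0 < r%:R ^+ 2 :> R by rewrite exprn_gt0 // ltr0n ltnW.
pose e : R := (4 * r%:R ^+ 2)^-1.
have e0 : 0 < e by rewrite invr_gt0 mulr_gt0.
have re : r%:R ^+ 2 * e = 1 / 4.
  by rewrite /e invfM mulrCA divff ?gt_eqF // mulr1 div1r.
have epoor : e < poor.
  have : r%:R ^+ 2 * e < r%:R ^+ 2 * poor by rewrite re; move: dense; rewrite mulrDr; lra.
  by rewrite ltr_pM2l.
have [u uS eu] : exists2 u, u \in S & e <= mass nu [set v | mass nu (common_in u v) <= 1 / 200].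
  apply: contrapT => nu_u; have : poor <= e.
    rewrite -[leRHS]mul1r -nu1 mulr_suml; apply: ler_sum => x _.
    have [xS|/nuS0->] := boolP (x \in S); last by rewrite !mul0r.
    rewrite ler_wpM2l // leNgt; apply/negP => /ltW ex.
    by apply: nu_u; exists x.
  by rewrite leNgt epoor.
apply: nclosed; apply: (blowup_exists tT nuS num half' p0 mp cyc uS).
rewrite -(ler_nat R); apply: le_trans (card_ge_mass _ num m0).
have -> : mass nu [set v in S | mass nu (common_in u v) <= 1 / 200] =
    mass nu [set v | mass nu (common_in u v) <= 1 / 200].
  rewrite /mass [LHS]big_mkcond [RHS]big_mkcond; apply: eq_bigr => v _.
  by rewrite !inE; have [//|/nuS0->] := boolP (v \in S); rewrite if_same.
apply: (@le_trans _ _ (e * m%:R)); last by rewrite ler_wpM2r // ltW.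
have : 4 * r%:R ^+ 2 * p%:R <= m%:R :> R by rewrite -natrX -!natrM ler_nat.
move=> h; have r4 : 0 < 4 * r%:R ^+ 2 :> R by lra.
by rewrite /e [leRHS]mulrC ler_pdivlMr // mulrC.
Qed.

Local Close Scope ring_scope.

Lemma out_le2_maps : exists2 C, 0 < C & forall (D : digraph) (p : nat),
  acyclic D -> out_le2 D -> 0 < p -> longest_path D <= p ->
  maps_to_tournaments D (C * p ^ 4).
Proof.
have [|r r2 rsmall] := @sample_size_exists rat (1 / 200)%R; first by apply/andP; split; lra.
have [K KE] : exists K, K = 80 * 160 ^ 3 by exists (80 * 160 ^ 3).
exists (K + 4 * r ^ 2).+1 => // D p acy out2 p0 lp T tT.
set C := (K + 4 * r ^ 2).+1 => cT.
have [l lE] := level_exists acy.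
have lltp x : l x < p by apply: leq_trans lp; apply: level_lt_longest_path.
suff [f fP] : maps_below l p [set: T].
  by exists f => x y xy; have [_] := fP x (lltp x); apply.
apply: contrapT => nmap.
have nmapS (S : {set T}) : ~ maps_below l p S.
  by move=> /(maps_below_sub (subsetT S)).
have cyc (X : {set T}) : p <= #|X| -> cyclic3 X.
  move=> pX; apply: contrapT => nc; apply: (nmapS X).
  by apply: maps_below_transitive => //; rewrite -card_gt0 (leq_trans p0).
(* [C] makes [m] meet both demands, [80 * (160 * p) ^ 3] for the blow-up and [4 * r ^ 2 * p] for the
   poor partners, while [p * m] vertices allow [p] rounds of peeling. *)
pose m := C * p ^ 3.
have m0 : 0 < m by rewrite muln_gt0 expn_gt0 p0.
have cTm : #|[set: T]| = p * m by rewrite cardsT cT /m mulnCA -expnS.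
have T0 : [set: T] != set0 by rewrite -card_gt0 cTm muln_gt0 p0.
have [|S S0 und] := @peel rat D T l p m setT lE out2 m0 T0 _ nmap; first by rewrite cTm.
have [|| Y Y0 Yc] := @closed_exists rat T S m p r tT S0 und cyc p0 r2 rsmall.
- by rewrite expnMn mulnA -KE leq_mul2r (leqW (leq_addr _ _)) orbT.
- apply: (@leq_trans (4 * r ^ 2 * p ^ 3)).
    by rewrite leq_mul2l -{1}(expn1 p) leq_pexp2l ?orbT.
  by rewrite leq_mul2r (leqW (leq_addl _ _)) orbT.
exact/(nmapS Y)/maps_below_closed.
Qed.

(** * Forbidden subgraphs *)

Lemma free_star03 (D : digraph) : acyclic D -> free_of (star 0 3) D -> out_le2 D.
Proof.
move=> acy fr x y1 y2 y3 xy1 xy2 xy3.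
have [->|n12] := eqVneq y1 y2; first by constructor 1.
have [->|n13] := eqVneq y1 y3; first by constructor 2.
have [->|n23] := eqVneq y2 y3; first by constructor 3.
case: (@free_seq _ _ D x [:: x; y1; y2; y3] fr) => //.
  rewrite /= !inE !negb_or n12 n13 n23.
  by rewrite (acyclic_neq acy xy1) (acyclic_neq acy xy2) (acyclic_neq acy xy3).
by move=> [[|[|[|[|i]]]] //= ?] [[|[|[|[|j]]]] //= ?].
Qed.

Lemma free_star30 (D : digraph) :
  acyclic D -> free_of (star 3 0) D -> out_le2 (reverse D).
Proof.
move=> acy fr x y1 y2 y3 xy1 xy2 xy3.
have [->|n12] := eqVneq y1 y2; first by constructor 1.
have [->|n13] := eqVneq y1 y3; first by constructor 2.
have [->|n23] := eqVneq y2 y3; first by constructor 3.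
case: (@free_seq _ _ D x [:: x; y1; y2; y3] fr) => //.
  rewrite /= !inE !negb_or ![x == _]eq_sym n12 n13 n23.
  by rewrite (acyclic_neq acy xy1) (acyclic_neq acy xy2) (acyclic_neq acy xy3).
by move=> [[|[|[|[|i]]]] //= ?] [[|[|[|[|j]]]] //= ?].
Qed.

Lemma free_star12 (D : digraph) : acyclic D -> free_of (star 1 2) D ->
  forall x y z w : D, darc y x -> darc x z -> darc x w -> z = w.
Proof.
move=> acy fr x y z w yx xz xw; apply: contrapT => /eqP zw.
case: (@free_seq _ _ D x [:: x; y; z; w] fr) => //.
  rewrite /= !inE !negb_or [x == y]eq_sym zw (acyclic_neq acy yx).
  rewrite (acyclic_neq acy xz) (acyclic_neq acy xw).
  by rewrite (acyclic_neq2 acy yx xz) (acyclic_neq2 acy yx xw).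
by move=> [[|[|[|[|i]]]] //= ?] [[|[|[|[|j]]]] //= ?].
Qed.

(** Stated in [reverse D], where the two in-neighbours of the centre become out-neighbours, so that
    one mapping lemma serves both stars. *)
Lemma free_star21 (D : digraph) : acyclic D -> free_of (star 2 1) D ->
  forall x y z w : reverse D, darc y x -> darc x z -> darc x w -> z = w.
Proof.
move=> acy fr x y z w yx xz xw; apply: contrapT => /eqP zw.
case: (@free_seq _ _ D x [:: x; z; w; y] fr) => //.
  rewrite /= !inE !negb_or ![x == _]eq_sym zw [y == x]eq_sym (acyclic_neq acy yx).
  rewrite (acyclic_neq acy xz) (acyclic_neq acy xw).
  by rewrite (acyclic_neq2 acy xz yx) (acyclic_neq2 acy xw yx).
by move=> [[|[|[|[|i]]]] //= ?] [[|[|[|[|j]]]] //= ?].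
Qed.

Lemma free_dir (D : digraph) : acyclic D -> free_of F_dir D -> longest_path D <= 3.
Proof.
move=> acy fr; have [s [us ss <-]] := longest_path_attained D.
case: s us ss => [|a [|b [|c [|d s]]]] // us ss; exfalso.
case: (@free_seq _ _ D a [:: a; b; c; d] fr) => //.
  by move: us; rewrite -[[:: a, b, c, d & s]]/([:: a; b; c; d] ++ s) cat_uniq => /and3P[].
case/and4P: ss => ab bc cd _.
by move=> [[|[|[|[|i]]]] //= ?] [[|[|[|[|j]]]] //= ?].
Qed.

Lemma free_turn (D : digraph) : acyclic D -> free_of F_turn D ->
  forall a b c d : D, darc a b -> darc b c -> darc d c -> d = a \/ d = b.
Proof.
move=> acy fr a b c d ab bc dc.
have [->|da] := eqVneq d a; first by left.
have [->|db] := eqVneq d b; first by right.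
case: (@free_seq _ _ D a [:: a; b; c; d] fr) => //.
  rewrite /= !inE !negb_or ![_ == d]eq_sym da db.
  rewrite (acyclic_neq acy ab) (acyclic_neq acy bc) (acyclic_neq acy dc).
  by rewrite (acyclic_neq2 acy ab bc).
by move=> [[|[|[|[|i]]]] //= ?] [[|[|[|[|j]]]] //= ?].
Qed.

Lemma free_alt (D : digraph) : acyclic D -> free_of F_alt D -> alt_free D.
Proof.
move=> acy fr a b c d ab cb cd ac bd; apply: contrapT => /eqP ad.
case: (@free_seq _ _ D a [:: a; b; c; d] fr) => //.
  rewrite /= !inE !negb_or [b == c]eq_sym ac bd ad.
  by rewrite (acyclic_neq acy ab) (acyclic_neq acy cb) (acyclic_neq acy cd).
by move=> [[|[|[|[|i]]]] //= ?] [[|[|[|[|j]]]] //= ?].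
Qed.

Theorem theorem1p3 :
  exists C : nat, forall H : acyclicOriented, 0 < #|H| ->
  forall reversed : bool,
  let free F := free_of (if reversed then reverse F else F) H in
  let p := longest_path H in
  ((free (star 0 3) \/ free (star 3 0) -> tau H <= C * p ^ 4) /\
   (free (star 1 2) \/ free (star 2 1) -> 2 <= p -> tau H <= 2 * p - 2)) /\
  ((free F_dir -> p <= 3 /\ tau H <= 4) /\
   (free F_turn -> 2 <= p -> tau H <= 2 * p - 2) /\
   (free F_alt -> tau H <= 3 * p - 2 /\
                  (triangle_free (@U H) -> tau H = p))).
Proof.
have [C C0 mapsC] := out_le2_maps; exists C => H H0 reversed free p.
have p0 : 0 < p := longest_path_gt0 H0.
(* If [H] omits a reversed pattern, then [reverse H] omits the pattern itself and has the same [p],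
   so both cases are treated through [E]. *)
pose E : digraph := if reversed then reverse H else H.
have freeE F : free F -> free_of F E.
  by rewrite /free /E; case: (reversed) => //; apply: free_reverse.
have acy : acyclic E.
  rewrite /E; case: (reversed); last exact: digraph_of_acyclic.
  exact/reverse_acyclic/digraph_of_acyclic.
have lpE : longest_path E = p.
  by rewrite /E; case: (reversed); rewrite ?reverse_longest_path.
have lp : longest_path E <= p by rewrite lpE.
have tauE n : 0 < n -> maps_to_tournaments E n -> tau H <= n.
  move=> n0 mapE; apply: tau_le => //; move: mapE; rewrite /E.
  by case: (reversed) => //; apply: reverse_maps_to.
have triE : triangle_free (@U H) -> triangle_free (@U E).
  rewrite /E; case: (reversed) => // tri x y z.
  have UC (v w : H) : @U (reverse H) v w = U v w by rewrite /U orbC.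
  by rewrite !UC; apply: tri.
(* [star b a] is [star a b] reversed, which is handled through [reverse E]. *)
have tauR n : 0 < n -> maps_to_tournaments (reverse E) n -> tau H <= n.
  by move=> n0 /reverse_maps_to; apply: tauE.
have acyR := reverse_acyclic acy.
have lpR : longest_path (reverse E) <= p by rewrite reverse_longest_path.
split; split.
- have n0 : 0 < C * p ^ 4 by rewrite muln_gt0 C0 expn_gt0 p0.
  case=> /freeE fr; first by apply: tauE => //; apply: mapsC => //; apply: free_star03.
  by apply: tauR => //; apply: mapsC => //; apply: free_star30.
- move=> fr p2; have n0 : 0 < 2 * p - 2 by lia.
  case: fr => /freeE fr; [apply: tauE | apply: tauR] => //;
    apply: unique_out_of_inner_maps => //; [exact: free_star12 | exact: free_star21].
- move=> /freeE/(free_dir acy) lp3; rewrite -lpE; split=> //.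
  by apply: tauE => //; apply: dir_free_maps.
split=> [/freeE fr p2|/freeE/(free_alt acy) alt].
  by apply: tauE; [lia | apply: turn_free_maps => //; apply: free_turn].
split=> [|tri]; first by apply: tauE; [lia | apply: alt_free_maps].
apply/eqP; rewrite eqn_leq tau_ge andbT; apply: tauE => //.
by apply: alt_triangle_free_maps => //; apply: triE.
Qed.
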